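(* (a) The 2-adic group tournament $(\mathbb Z[2],\widehat A)$ is an arc cyclic, prime topological tournament on a Cantor set. (b) The homeomorphism $x\mapsto -x$ of $\mathbb Z[2]$ is an isomorphism from $(\mathbb Z[2],\widehat A)$ to $(\mathbb Z[2],\widehat A^{-1})$. (c) For each $k\in\mathbb N$ and $w\in\{0,1\}^k$, the shift $\sigma^k:I_w\to\mathbb Z[2]$ is an isomorphism from the restriction $\widehat A|I_w$ to $\widehat A$. (d) For each $x\in\mathbb Z[2]$ the restriction of $\widehat A$ to $\widehat A(x)$ is isomorphic to the topological lexicographic product $\bar N_1\ltimes\{(Y_a,S_a):a\in\mathbb N^*\}$ with $(Y_i,S_i)=(\mathbb Z[2],\widehat A)$ for $i\in\mathbb N$ and $(Y_\infty,S_\infty)$ trivial; the projection map to $\bar N_1=(\mathbb N^*,L_1^{-1})$ is given by $x+A_i\mapsto i$ and $x\mapsto\infty$. The restriction of $\widehat A$ to $\widehat A^{-1}(x)$ is isomorphic to the topological lexicographic product $N_1\ltimes\{(Y_a,S_a):a\in\mathbb N^*\}$ with $(Y_i,S_i)=(\mathbb Z[2],\widehat A)$ for $i\in\mathbb N$ and $(Y_\infty,S_\infty)$ trivial; the projection map to $N_1=(\mathbb N^*,L_1)$ is given by $x+(-A_i)\mapsto i$ and $x\mapsto\infty$. In each case, the two-level product is the classifier of the restriction: that is, the inverse system whose first term is $\bar N_1$ (resp. $N_1$), whose terms from the second on are all equal to the topological lexicographic product $\bar N_1\ltimes\{(Y_a,S_a):a\in\mathbb N^*\}$ (resp. $N_1\ltimes\{(Y_a,S_a):a\in\mathbb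 N^*\}$) with $(Y_i,S_i)=(\mathbb Z[2],\widehat A)$ for $i\in\mathbb N$ and $(Y_\infty,S_\infty)$ trivial, with $f_1$ the first coordinate projection and all later $f_i$ identities, together with the corresponding maps from the restriction, is a classifier system for the restriction.
   Context: All spaces are Hausdorff; $\mathbb N=\{1,2,\dots\}$. A tournament on a nonempty set $X$ is a relation $R\subset X\times X$ with $R\cap R^{-1}=1_X$ (the diagonal) and $R\cup R^{-1}=X\times X$; $R^\circ=R\setminus1_X$; $R(x)=\{y:(x,y)\in R\}$; $R|A=R\cap(A\times A)$; write $x\rightharpoonup y$ for $(x,y)\in R^\circ$. It is topological if $R$ is closed in $X\times X$, compact if also $X$ is compact, trivial if $|X|=1$, and an arc if $|X|=2$. It is arc cyclic if every arc $(x_1,x_2)\in R^\circ$ is contained in a 3-cycle $\{x_1,x_2,x_3\}$, $x_1\rightharpoonup x_2\rightharpoonup x_3\rightharpoonup x_1$. A quotient map $h:(X_2,R_2)\to(X_1,R_1)$ of compact topological tournaments is a continuous surjection with $(h\times h)(R_2)\subset R_1$; it is an isomorphism if injective. A nontrivial compact topological tournament is prime if its only quotient maps onto nontrivial tournaments are isomorphisms. $\mathbb Z[2]$ is the topological group of 2-adic integers, written as $\{0,1\}^{\mathbb N}$ with addition coordinatewise mod 2 with carrying to the right. For $i\in\mathbb N$, $A_i=\{0^{i-1}10z:z\in\mathbb Z[2]\}$ (sequences with $i-1$ zeros, then $1$, then $0$, then arbitrary), so $-A_i=\{0^{i-1}11z\}$. Let $A=\{0\}\cup\bigcup_iA_i$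 and $\widehat A=\{(x,y):y-x\in A\}$. For $w\in\{0,1\}^k$, $I_w$ is the set of sequences in $\mathbb Z[2]$ beginning with $w$; $\sigma(y)_i=y_{i+1}$, so $\sigma^k:I_w\to\mathbb Z[2]$, $wx\mapsto x$, is a bijection. $\mathbb N^*=\mathbb N\cup\{\infty\}$ is the one-point compactification of $\mathbb N$. $L_1$ is the tournament on $\mathbb N^*$ with $i+1\rightharpoonup i$ for $i\in\mathbb N$ and $i\rightharpoonup j$ whenever $i+1<j\le\infty$. $N_1=(\mathbb N^*,L_1)$, $\bar N_1=(\mathbb N^*,L_1^{-1})$. Topological lexicographic product $(X_1,R_1)\ltimes\{(Y_x,S_x)\}$ (with $(Y_x,S_x)$ trivial for $x$ non-isolated in $X_1$): the tournament on $\bigcup_x\{x\}\times Y_x$ with $((x,y),(x',y'))$ related iff $(x,x')\in R_1^\circ$, or $x=x'$ and $(y,y')\in S_x$; topology with basis $\pi^{-1}(V)$, $V$ open in $X_1$, and $\{x\}\times V$ with $x$ isolated and $V$ open in $Y_x$, where $\pi$ is the first coordinate projection. A cycle point is a point each of whose neighborhoods contains a 3-cycle including it; a compact topological tournament is wac if every non-isolated point is a cycle point, and almost wac if every point is isolated, a cycle point, initial ($R^{\circ-1}(x)=\emptyset$) or terminal ($R^\circ(x)=\emptyset$). A base quotient map of a wac tournament, or of an almost wac tournament without a quotient map onto an arc, is: a quotient map onto a prime tournament if the tournament is nontrivial and has no quotient map onto an arc; if it has a quotient map onto an arc (wac case), a quotient map onto a finite linear order on at least two points such that no fiber restriction has a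 quotient map onto an arc; the map onto a trivial tournament if it is trivial. A classifier system for such $(X,R)$ is a sequence of compact topological tournaments $(X_i,R_i)$ with quotient maps $f_i:(X_{i+1},R_{i+1})\to(X_i,R_i)$ and $h_i:(X,R)\to(X_i,R_i)$, $h_i=f_i\circ h_{i+1}$, such that $h_1$ is a base quotient map and for each $x_i\in X_i$ the restriction of $R$ to $h_i^{-1}(x_i)$ is wac and $h_{i+1}$ restricts to a base quotient map from $h_i^{-1}(x_i)$ to $f_i^{-1}(x_i)$ (with restricted tournaments). *)

(* Defs.v *)
(* Sequences indexed by {1, 2, ...} are indexed
   here by nat, so every index i below stands for i + 1 in the 1-based
   convention; infinity is the point None of the compactification of nat. *)
From HB Require Import structures.
From mathcomp Require Import all_boot all_order all_algebra.
From mathcomp Require Import all_classical all_reals all_analysis.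

Set Implicit Arguments.
Unset Strict Implicit.
Unset Printing Implicit Defensive.

Import Order.TTheory GRing.Theory.

Local Open Scope classical_set_scope.
Local Open Scope card_scope.
Local Open Scope ring_scope.

Definition homeomorphism (X Y : topologicalType) (f : X -> Y) : Prop :=
  exists g : Y -> X,
    [/\ cancel f g, cancel g f, continuous f & continuous g].

Definition cantor_set (X : topologicalType) : Prop :=
  exists f : X -> cantor_space, homeomorphism f.

Definition strict_part (X : Type) (R : set (X * X)) : set (X * X) :=
  R `\` diagonal.

Definition is_tournament (X : Type) (R : set (X * X)) : Prop :=
  [/\ [set: X] !=set0,
      R `&` R^-1%relation = diagonal &
      R `|` R^-1%relation = setT].

Definition topological_tournament (X : topologicalType) (R : set (X * X)) :
    Prop :=
  [/\ hausdorff_space X, is_tournament R & closed R].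

Definition compact_tournament (X : topologicalType) (R : set (X * X)) : Prop :=
  topological_tournament R /\ compact [set: X].

Definition restr_rel (X : Type) (R : set (X * X)) (A : set X) : set (A * A) :=
  [set p | R (set_val p.1, set_val p.2)].
Arguments restr_rel {X} R A.

Definition trivial (X : Type) : Prop := [set: X] #= `I_1.

Definition two_points (X : Type) : Prop := [set: X] #= `I_2.

Definition cycle3 (X : Type) (R : set (X * X)) (x y z : X) : Prop :=
  [/\ strict_part R (x, y), strict_part R (y, z) & strict_part R (z, x)].

Definition arc_cyclic (X : Type) (R : set (X * X)) : Prop :=
  forall x1 x2, strict_part R (x1, x2) -> exists x3, cycle3 R x1 x2 x3.

Definition quotient_map (X2 X1 : topologicalType) (R2 : set (X2 * X2))
    (R1 : set (X1 * X1)) (h : X2 -> X1) : Prop :=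
  [/\ compact_tournament R2, compact_tournament R1, continuous h,
      set_surj setT setT h &
      forall x y, R2 (x, y) -> R1 (h x, h y)].

Definition isomorphism (X2 X1 : topologicalType) (R2 : set (X2 * X2))
    (R1 : set (X1 * X1)) (h : X2 -> X1) : Prop :=
  quotient_map R2 R1 h /\ injective h.

Definition prime_tournament (X : topologicalType) (R : set (X * X)) : Prop :=
  [/\ compact_tournament R, ~ trivial X &
      forall (Y : topologicalType) (S : set (Y * Y)) (h : X -> Y),
        ~ trivial Y -> quotient_map R S h -> isomorphism R S h].

Definition has_arc_quotient (X : topologicalType) (R : set (X * X)) : Prop :=
  exists (Y : topologicalType) (S : set (Y * Y)) (h : X -> Y),
    two_points Y /\ quotient_map R S h.

Definition cycle_point (X : topologicalType) (R : set (X * X)) (x : X) : Prop :=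
  forall U, nbhs x U -> exists y z, [/\ U y, U z & cycle3 R x y z].

Definition initial_point (X : Type) (R : set (X * X)) (x : X) : Prop :=
  xsection (strict_part R)^-1%relation x = set0.

Definition terminal_point (X : Type) (R : set (X * X)) (x : X) : Prop :=
  xsection (strict_part R) x = set0.

Definition wac (X : topologicalType) (R : set (X * X)) : Prop :=
  compact_tournament R /\
  forall x, ~ isolated [set: X] x -> cycle_point R x.

Definition almost_wac (X : topologicalType) (R : set (X * X)) : Prop :=
  compact_tournament R /\
  forall x, [\/ isolated [set: X] x, cycle_point R x,
                initial_point R x | terminal_point R x].

(* A tournament is reflexive, antisymmetric and total, so that it is a linear
   order exactly when it is transitive. *)
Definition finite_linear_order (X : Type) (R : set (X * X)) : Prop :=
  [/\ finite_set [set: X], is_tournament R &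
      forall x y z, R (x, y) -> R (y, z) -> R (x, z)].

Definition base_quotient_map (X Y : topologicalType) (R : set (X * X))
    (S : set (Y * Y)) (h : X -> Y) : Prop :=
  [/\ quotient_map R S h,
      wac R \/ almost_wac R /\ ~ has_arc_quotient R,
      trivial X -> trivial Y,
      ~ trivial X -> ~ has_arc_quotient R -> prime_tournament S &
      has_arc_quotient R ->
        [/\ finite_linear_order S, ~ trivial Y &
            forall y, ~ has_arc_quotient (restr_rel R (h @^-1` [set y]))]].

Definition classifier_system (X : topologicalType) (R : set (X * X))
    (Xs : nat -> topologicalType) (Rs : forall i, set (Xs i * Xs i))
    (f : forall i, Xs i.+1 -> Xs i) (h : forall i, X -> Xs i) : Prop :=
  [/\ forall i, quotient_map (Rs i.+1) (Rs i) (f i),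
      forall i, quotient_map R (Rs i) (h i),
      forall i x, h i x = f i (h i.+1 x),
      base_quotient_map R (Rs 0%N) (h 0%N) &
      forall i (a : Xs i),
        wac (restr_rel R (h i @^-1` [set a])) /\
        exists g : h i @^-1` [set a] -> f i @^-1` [set a],
          (forall x, set_val (g x) = h i.+1 (set_val x)) /\
          base_quotient_map (restr_rel R (h i @^-1` [set a]))
            (restr_rel (Rs i.+1) (f i @^-1` [set a])) g].

(* The inverse system with first term (X1, R1), all later terms (X2, R2), first
   bonding map p and all later ones the identity, together with the maps into
   its terms induced by phi : X -> X2. *)
Section TwoLevel.
Variables (X X1 X2 : topologicalType).
Variables (R1 : set (X1 * X1)) (R2 : set (X2 * X2)).
Variables (p : X2 -> X1) (phi : X -> X2).

Definition two_level_space (i : nat) : topologicalType :=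
  if i is _.+1 then X2 else X1.

Definition two_level_rel (i : nat) :
    set (two_level_space i * two_level_space i) :=
  match i return set (two_level_space i * two_level_space i) with
  | 0 => R1
  | _.+1 => R2
  end.

Definition two_level_bond (i : nat) :
    two_level_space i.+1 -> two_level_space i :=
  match i return X2 -> two_level_space i with
  | 0 => p
  | _.+1 => id
  end.

Definition two_level_map (i : nat) : X -> two_level_space i :=
  match i return X -> two_level_space i with
  | 0 => p \o phi
  | _.+1 => phi
  end.

End TwoLevel.
Arguments two_level_space : clear implicits.
Arguments two_level_rel {X1 X2} R1 R2 i.
Arguments two_level_bond {X1 X2} p i.
Arguments two_level_map {X X1 X2} p phi i.

(* The topological lexicographic product.  The total space is an alias of the
    sigma type, whose library topology is the disjoint union topology.  The
    definition is intended for Y x a singleton when x is not isolated. *)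

Definition lexprod (X : topologicalType) (Y : X -> topologicalType) : Type :=
  {x : X & Y x}.

Section LexProd.
Variables (X : topologicalType) (Y : X -> topologicalType).

HB.instance Definition _ := Choice.copy (lexprod Y) {x : X & Y x}.

Definition lexprod_proj (u : lexprod Y) : X := projT1 u.

Definition lexprod_base : set (set (lexprod Y)) :=
  [set lexprod_proj @^-1` V | V in open] `|`
  [set U | exists x (V : set (Y x)),
     [/\ isolated [set: X] x, open V & U = existT _ x @` V]].

Let lexprod_base_cover : \bigcup_(U in lexprod_base) U = setT.
Proof.
apply/seteqP; split => // u _; exists setT => //.
by left; exists setT; [exact: openT|].
Qed.

Let lexprod_base_join (U V : set (lexprod Y)) u :
  lexprod_base U -> lexprod_base V -> U u -> V u ->
  exists W, [/\ lexprod_base W, W u & W `<=` U `&` V].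
Proof.
have mixed (C : set X) x (A : set (Y x)) : open C -> isolated [set: X] x ->
    open A -> C (lexprod_proj u) -> (existT _ x @` A) u ->
    exists W, [/\ lexprod_base W, W u &
      W `<=` lexprod_proj @^-1` C `&` (existT _ x @` A)].
  move=> oC ix oA Ou Au; exists (existT _ x @` A); split => //.
    by right; exists x, A.
  by case: Au Ou => a Aa <- /= Ox w [b Ab <-]; split => //; exists b.
move=> [[C oC <-]|[x [A [ix oA ->]]]] [[P oP <-]|[y [B [iy oB ->]]]] Uu Vu.
- exists (lexprod_proj @^-1` (C `&` P)); split => //.
  by left; exists (C `&` P) => //; exact: openI.
- exact: mixed.
- by rewrite setIC; exact: mixed.
- case: Vu Uu => b Bb <- [a Aa ab].
  have xy : x = y by exact: (congr1 (@projT1 _ _) ab).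
  subst y; have {}ab : a = b by exact: eq_from_Tagged ab.
  subst b; exists (existT _ x @` (A `&` B)); split.
  + by right; exists x, (A `&` B); split => //; exact: openI.
  + by exists a.
  + by move=> w [d [Ad Bd] <-]; split; exists d.
Qed.

HB.instance Definition _ := @isBaseTopological.Build (lexprod Y)
  (set (lexprod Y)) lexprod_base id lexprod_base_cover lexprod_base_join.

Definition lexprod_rel (R : set (X * X)) (S : forall x, set (Y x * Y x)) :
    set (lexprod Y * lexprod Y) :=
  [set p | strict_part R (lexprod_proj p.1, lexprod_proj p.2) \/
     exists x (y y' : Y x),
       [/\ p.1 = existT _ x y, p.2 = existT _ x y' & S x (y, y')]].

End LexProd.

(* The 2-adic integers, x n being the coefficient of 2 ^ n.  The alias is needed
   because cantor_space itself inherits the pointwise addition of bool. *)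

Definition Z2 : Type := cantor_space.

HB.instance Definition _ := Choice.on Z2.
HB.instance Definition _ := Topological.copy Z2 cantor_space.

Fixpoint Z2_carry (x y : Z2) (n : nat) : bool :=
  if n is m.+1 then
    (x m && y m) || (Z2_carry x y m && (x m || y m))
  else false.

Definition Z2_zero : Z2 := fun=> false.

Definition Z2_add (x y : Z2) : Z2 := fun n => x n (+) y n (+) Z2_carry x y n.

(* Negation keeps the digits up to the first 1 and flips all later ones. *)
Definition Z2_opp (x : Z2) : Z2 := fun n => x n (+) has x (iota 0 n).

Lemma Z2_addC : commutative Z2_add.
Proof.
move=> x y; apply/funext => n; rewrite /Z2_add (addbC (x n)); congr addb.
by elim: n => //= n ->; rewrite andbC (orbC (x n)).
Qed.

Lemma Z2_addA : associative Z2_add.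
Proof.
move=> x y z.
set c := Z2_carry x y; set d := Z2_carry (Z2_add x y) z.
set c' := Z2_carry y z; set d' := Z2_carry x (Z2_add y z).
(* Both bracketings carry the same total into each digit. *)
have E n : c n (+) d n = c' n (+) d' n /\ c n && d n = c' n && d' n.
  elim: n => // n; rewrite /c /d /c' /d' /= /Z2_add.
  by move: (Z2_carry _ _ n) (Z2_carry _ _ n) (Z2_carry _ _ n) (Z2_carry _ _ n)
    (x n) (y n) (z n) => [] [] [] [] [] [] [] [].
apply/funext => n; have [+ _] := E n; rewrite /Z2_add -/c -/d -/c' -/d'.
by move: (c n) (d n) (c' n) (d' n) (x n) (y n) (z n) => [] [] [] [] [] [] [].
Qed.

Lemma Z2_add0 : left_id Z2_zero Z2_add.
Proof.
move=> x; apply/funext => n; rewrite /Z2_add /=.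
suff -> : Z2_carry Z2_zero x n = false by rewrite addbF.
by elim: n => //= n ->.
Qed.

Lemma Z2_addN : left_inverse Z2_zero Z2_opp Z2_add.
Proof.
move=> x; apply/funext => n; rewrite Z2_addC /Z2_add.
suff -> : Z2_carry x (Z2_opp x) n = has x (iota 0 n).
  by rewrite /Z2_opp addbA addbb addbK.
elim: n => // n IH; rewrite -[in RHS]addn1 iotaD has_cat /= orbF add0n IH.
by rewrite /Z2_opp; case: (x n); case: has.
Qed.

HB.instance Definition _ :=
  GRing.isZmodule.Build Z2 Z2_addA Z2_addC Z2_add0 Z2_addN.

Lemma Z2_addE (x y : Z2) n : (x + y) n = x n (+) y n (+) Z2_carry x y n.
Proof. by []. Qed.

Lemma Z2_oppE (x : Z2) n : (- x) n = x n (+) has x (iota 0 n).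
Proof. by []. Qed.

Lemma Z2_cvg (T : topologicalType) (f : T -> Z2) (t : T) :
  (forall n, \forall u \near t, f u n = f t n) -> f u @[u --> t] --> f t.
Proof.
move=> fn; apply/cvg_sup => n U [_ [[V _ <-] Vt] sVU].
by apply: filterS (fn n) => u fu; apply: sVU; rewrite /= fu.
Qed.

Lemma Z2_near_coord (x : Z2) (n : nat) : \forall u \near x, u n = x n.
Proof.
have /discrete_cvg := @proj_continuous _ (fun=> bool) n x; apply.
Qed.

Lemma Z2_add_continuous : continuous (fun x : Z2 * Z2 => x.1 + x.2).
Proof.
move=> x; apply: Z2_cvg => n.
have n1 m : \forall u \near x, u.1 m = x.1 m.
  exists ([set u : Z2 | u m = x.1 m], setT); last by move=> u [].
  by split; [exact: Z2_near_coord|exact: filterT].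
have n2 m : \forall u \near x, u.2 m = x.2 m.
  exists (setT, [set u : Z2 | u m = x.2 m]); last by move=> u [].
  by split; [exact: filterT|exact: Z2_near_coord].
have nc : \forall u \near x, Z2_carry u.1 u.2 n = Z2_carry x.1 x.2 n.
  elim: n => [|n IH]; first by apply: filterE => u.
  by apply: filterS3 (n1 n) (n2 n) IH => u /= -> -> ->.
by apply: filterS3 (n1 n) (n2 n) nc => u un vn cn; rewrite !Z2_addE un vn cn.
Qed.

Lemma Z2_opp_continuous : continuous (-%R : Z2 -> Z2).
Proof.
move=> x; apply: Z2_cvg => n.
have nh : \forall u \near x, has u (iota 0 n) = has x (iota 0 n).
  elim: (iota 0 n) => [|m s IH]; first by apply: filterE => u.
  by apply: filterS2 (Z2_near_coord x m) IH => u /= -> ->.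
by apply: filterS2 (Z2_near_coord x n) nh => y; exact: congr2.
Qed.

HB.instance Definition _ :=
  PreTopologicalNmodule_isTopologicalNmodule.Build Z2 Z2_add_continuous.
HB.instance Definition _ :=
  TopologicalNmodule_isTopologicalZmodule.Build Z2 Z2_opp_continuous.

Definition Z2_shift (x : Z2) : Z2 := fun n => x n.+1.

Definition cylinder (k : nat) (w : k.-tuple bool) : set Z2 :=
  [set x | forall i : 'I_k, x i = tnth w i].

(* The set of all 0^i 1 0 z. *)
Definition Apart (i : nat) : set Z2 :=
  [set x | [/\ forall j, (j < i)%N -> x j = false, x i = true &
               x i.+1 = false]].

Definition Aset : set Z2 := [set 0] `|` \bigcup_i Apart i.

Definition Ahat : set (Z2 * Z2) := [set p | Aset (p.2 - p.1)].

Notation Nstar := (one_point_compactification nat).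

Definition L1 : set (Nstar * Nstar) :=
  [set p | match p.1, p.2 with
           | Some i, Some j => [|| i == j, i == j.+1 | (i.+1 < j)%N]
           | Some _, None => true
           | None, Some _ => false
           | None, None => true
           end].

Definition Yfam (a : Nstar) : topologicalType :=
  if a is Some _ then Z2 else discrete_topology unit.

Definition Sfam (a : Nstar) : set (Yfam a * Yfam a) :=
  match a return set (Yfam a * Yfam a) with
  | Some _ => Ahat
  | None => setT
  end.
Arguments Sfam : clear implicits.

Definition lexN (T : set (Nstar * Nstar)) : set (lexprod Yfam * lexprod Yfam) :=
  lexprod_rel T Sfam.

(* Main.v *)
Require Import Defs.
From HB Require Import structures.
From mathcomp Require Import all_boot all_order all_algebra.
From mathcomp Require Import all_classical all_reals all_analysis.
From mathcomp Require Import zify.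

Set Implicit Arguments.
Unset Strict Implicit.
Unset Printing Implicit Defensive.

Import Order.TTheory GRing.Theory.

Local Open Scope classical_set_scope.
Local Open Scope ring_scope.

(** Subtraction of 2-adic integers is local enough that the group can be traded
    for digits: if n is the first digit at which x and y differ, then y - x has
    its leading 1 at n, and its next digit is x (n+1) + y (n+1) plus the borrow
    x n (mod 2).  So there is an arc from x to y exactly when
    x (n+1) + y (n+1) = x n (mod 2); this is [arc_at], and [Ahat_arc] says that
    it describes Ahat.  The rule sees only the two digits from the first
    difference on; this makes Ahat closed, and makes the shift of a cylinder an
    isomorphism.  Flipping digit n+1 of y, and correcting digit
    n+2, closes an arc from x to y to a 3-cycle that stays within the prefix
    common to x and y ([arc_cycle]): Ahat is arc cyclic, and every point is a
    cycle point.

    A fiber of a quotient map is closed, and convex: it contains every c with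
    a -> c -> b for two of its elements a and b.  Hence primality follows once
    every closed convex set with two points is the whole space
    ([prime_of_convex]).  For Ahat, let a -> b both lie in such a set C, with
    first difference n, the level of the arc.  The points reached from a at a
    level beyond n+1 lie between a and b; those reached at level k lie between a
    and those reached at level k+1.  So C contains the whole out-set of a, and
    then, by arc cyclicity, also the in-set.  The same criterion proves L1
    prime: an arc between neighbours spreads to both sides, and every other arc
    leads to such an arc.

    The out-set and the in-set of x are treated together.  They consist
    of the y such that y - x is zero, or has a leading 1 followed by a fixed
    digit e, with e = 0 for the out-set and e = 1 for the in-set ([rayP]).
    Recording the position of the leading 1 and the digits behind these two maps
    such a set onto the product ([lex_coord]).  Two points with leading
    positions i < j differ first at i, and digit i+1 of the second is 1
    precisely when j = i+1: their arc therefore depends on e and on whether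
    j = i+1, which is the rule defining L1 and its reverse ([lex_coord_lt]).

    For the classifier, a 3-cycle cannot be separated by a quotient onto an arc.
    The 3-cycles inside the fibers and those formed by three consecutive indices
    link all points but the one at infinity, which is a limit of the others; so
    the restriction has no quotient onto an arc ([lexN_no_arc]), and its
    projection onto the prime L1 or its reverse is a base quotient map.  The
    nontrivial fibers are copies of the prime tournament Ahat, and all further
    fibers are points. *)

(** * Topological preliminaries *)

Definition set_elt (X : Type) (A : set X) (x : X) (Ax : A x) : A :=
  exist (fun y => y \in A) x (mem_set Ax).

Lemma set_eltE (X : Type) (A : set X) (x : X) (Ax : A x) :
  set_val (set_elt Ax) = x.
Proof. by rewrite set_valE. Qed.

Lemma set_val_continuous (X : topologicalType) (A : set X) :
  continuous (set_val : A -> X).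
Proof. exact: initial_continuous. Qed.

Lemma continuous_set_val (X Y : topologicalType) (A : set Y) (f : X -> A) :
  continuous (fun x => set_val (f x)) -> continuous f.
Proof. exact: continuous_comp_initial. Qed.

Lemma set_val_inj (X : Type) (A : set X) : injective (set_val : A -> X).
Proof. by move=> x y; rewrite set_valE; exact: val_inj. Qed.

Lemma hausdorff_inj (X Y : topologicalType) (f : X -> Y) :
  continuous f -> injective f -> hausdorff_space Y -> hausdorff_space X.
Proof.
move=> cf fI hY p q pq; apply/fI/hY => A B Ap Bq.
by have [x [Ax Bx]] := pq _ _ (cf _ _ Ap) (cf _ _ Bq); exists (f x).
Qed.

Lemma hausdorff_prod (X Y : topologicalType) :
  hausdorff_space X -> hausdorff_space Y -> hausdorff_space (X * Y)%type.
Proof.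
move=> hX hY [a b] [c d] cl; congr pair.
  apply: hX => A B Aa Bc.
  have [||[x y] [Ax Bx]] := cl (fst @^-1` A) (fst @^-1` B).
  - exact: cvg_fst Aa.
  - exact: cvg_fst Bc.
  - by exists x.
apply: hY => A B Ab Bd.
have [||[x y] [Ay By]] := cl (snd @^-1` A) (snd @^-1` B).
- exact: cvg_snd Ab.
- exact: cvg_snd Bd.
- by exists y.
Qed.

Lemma compact_set_type (X : topologicalType) (A : set X) :
  compact A -> compact [set: A].
Proof.
move=> cA F FF _.
have FA : (set_val @ F) A.
  suff -> : (set_val @ F) A = F setT by exact: filterT.
  by congr F; apply/seteqP; split => // y _; exact: set_valP.
have [p [Ap clp]] := cA _ _ FA.
exists (set_elt Ap); split => // B C FB [_ [[W oW <-] Wp sWC]].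
have FB' : (set_val @ F) (set_val @` B) 
  by apply: (@filterS _ F _ B) => // y By; exists y.
have [|_ [[y By <-] Wy]] := clp _ W FB'.
  by apply: open_nbhs_nbhs; split => //; move: Wp; rewrite /= set_eltE.
by exists y; split => //; exact: sWC.
Qed.

Lemma hausdorff_closed1 (X : topologicalType) (x : X) :
  hausdorff_space X -> closed [set x].
Proof. by move=> /hausdorff_accessible /accessible_closed_set1; exact. Qed.

Lemma continuous_image_compact (X Y : topologicalType) (f : X -> Y) A :
  continuous f -> compact A -> compact (f @` A).
Proof. by move=> cf; apply: continuous_compact; exact: continuous_subspaceT. Qed.

Lemma continuous_pair (X1 X2 Y1 Y2 : topologicalType) (f : X1 -> Y1)
    (g : X2 -> Y2) :
  continuous f -> continuous g ->
  continuous (fun p : X1 * X2 => (f p.1, g p.2)).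
Proof.
by move=> cf cg p; apply: cvg_pair; apply: continuous_comp;
   [exact: cvg_fst|exact: cf|exact: cvg_snd|exact: cg].
Qed.

(** A continuous bijection from a compact space onto a Hausdorff space is a
    closed map. *)
Lemma compact_bij_inv (X Y : topologicalType) (h : X -> Y) :
  compact [set: X] -> hausdorff_space Y -> continuous h -> injective h ->
  set_surj setT setT h ->
  exists g, [/\ cancel h g, cancel g h & continuous g].
Proof.
move=> cX hY ch hI hs.
have hs' y : {x | h x = y} by apply: cid; have [//|x _ <-] := hs y; exists x.
pose g y := sval (hs' y).
have gK : cancel g h by move=> y; rewrite /g; case: (hs' y).
have hK : cancel h g by move=> x; apply: hI; rewrite gK.
exists g; split => //; apply/continuous_closedP => C clC.
have -> : g @^-1` C = h @` C.
  by apply/seteqP; split => [y Cy|_ [x Cx <-]]; [exists (g y)|rewrite /= hK].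
apply: (compact_closed hY); apply: continuous_image_compact => //.
exact: subclosed_compact clC cX _.
Qed.

(** * Tournaments, restrictions and quotient maps *)

Lemma strictE (X : Type) (R : set (X * X)) x y :
  strict_part R (x, y) <-> R (x, y) /\ x <> y.
Proof. by []. Qed.

Lemma tournament_intro (X : Type) (R : set (X * X)) :
  [set: X] !=set0 -> (forall x, R (x, x)) ->
  (forall x y, R (x, y) -> R (y, x) -> x = y) ->
  (forall x y, R (x, y) \/ R (y, x)) -> is_tournament R.
Proof.
move=> X0 Rxx Ra Rt; split => //.
  apply/seteqP; split => -[x y] /=; first by move=> [/= xy yx]; exact: Ra.
  by move=> /diagonalP ->; split; exact: Rxx.
by apply/seteqP; split => -[x y] // _; have [|] := Rt x y; [left|right].
Qed.

Lemma tournament_refl (X : Type) (R : set (X * X))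
    (tR : is_tournament R) x :
  R (x, x).
Proof.
by case: tR => _ RI _; have : diagonal (x, x) by []; rewrite -RI => -[].
Qed.

Lemma tournament_anti (X : Type) (R : set (X * X))
    (tR : is_tournament R) x y :
  R (x, y) -> R (y, x) -> x = y.
Proof.
move=> xy yx; case: tR => _ RI _.
by have : diagonal (x, y) by rewrite -RI.
Qed.

Lemma tournament_total (X : Type) (R : set (X * X))
    (tR : is_tournament R) x y :
  R (x, y) \/ R (y, x).
Proof. by case: tR => _ _ RU; have : setT (x, y) by []; rewrite -RU. Qed.

Lemma tournament_trichotomy (X : Type) (R : set (X * X))
    (tR : is_tournament R) x y :
  [\/ x = y, strict_part R (x, y) | strict_part R (y, x)].
Proof.
have [->|xy] := pselect (x = y); first by constructor 1.
have [?|?] := tournament_total tR x y; [constructor 2|constructor 3] => //.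
by split => //= yx; exact: xy.
Qed.

Lemma tournament_inv (X : Type) (R : set (X * X))
    (tR : is_tournament R) :
  is_tournament (R^-1)%relation.
Proof.
apply: tournament_intro; first by case: tR.
- exact: (tournament_refl tR).
- by move=> x y xy yx; exact: (tournament_anti tR).
- by move=> x y; exact: (tournament_total tR y x).
Qed.

Lemma tournament_inj (X : Type) (R : set (X * X))
    (tR : is_tournament R)
    (Z : Type) (f : Z -> X) :
  [set: Z] !=set0 -> injective f ->
  is_tournament [set p | R (f p.1, f p.2)].
Proof.
move=> Z0 fI; apply: tournament_intro => //.
- by move=> z; exact: (tournament_refl tR).
- by move=> x y xy yx; apply: fI; exact: (tournament_anti tR).
- by move=> x y; exact: (tournament_total tR).
Qed.

Lemma compact_tournament_inv (X : topologicalType) (R : set (X * X)) :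
  compact_tournament R -> compact_tournament (R^-1)%relation.
Proof.
move=> [[hX tR clR] cX]; split => //; split => //; first exact: tournament_inv.
apply: (preimage_closed _ clR) => p _.
exact: swap_continuous.
Qed.

Lemma restr_compact_tournament (X : topologicalType) (R : set (X * X))
    (A : set X) :
  compact_tournament R -> closed A -> A !=set0 ->
  compact_tournament (restr_rel R A).
Proof.
move=> [[hX tR clR] cX] clA A0; split; [split|].
- exact: hausdorff_inj (@set_val_continuous _ A) (@set_val_inj _ A) hX.
- apply: (tournament_inj tR (f := set_val)); last exact: (@set_val_inj _ A).
  by case: A0 => x Ax; exists (set_elt Ax).
- apply: (preimage_closed _ clR) => p _.
  by apply: continuous_pair; exact: set_val_continuous.
- by apply: compact_set_type; exact: subclosed_compact clA cX _.
Qed.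

Lemma quotient_map_id (X : topologicalType) (R : set (X * X)) :
  compact_tournament R -> quotient_map R R id.
Proof. by move=> cR; split => // x; exact: cvg_id. Qed.

Lemma quotient_map_comp (X Y Z : topologicalType) (R : set (X * X))
    (S : set (Y * Y)) (T : set (Z * Z)) f g :
  quotient_map R S f -> quotient_map S T g -> quotient_map R T (g \o f).
Proof.
move=> [cR cS cf fs fm] [_ cT cg gs gm]; split => //.
- by move=> x; apply: continuous_comp; [exact: cf|exact: cg].
- move=> z _; have [//|y _ <-] := gs z; have [//|x _ <-] := fs y.
  by exists x.
- by move=> x y /fm /gm.
Qed.

Lemma quotient_map_inv (X Y : topologicalType) (R : set (X * X))
    (S : set (Y * Y)) h :
  quotient_map R S h -> quotient_map (R^-1)%relation (S^-1)%relation h.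
Proof.
move=> [cR cS ch hs hm]; split => //; try exact: compact_tournament_inv.
by move=> x y; exact: hm.
Qed.

(** The structure of S is transported from R, so that compactness of Y and
    closedness of S come for free: S is the image of the compact set R. *)
Lemma isomorphism_intro (X Y : topologicalType) (R : set (X * X))
    (S : set (Y * Y)) (h : X -> Y) :
  compact_tournament R -> hausdorff_space Y -> continuous h -> injective h ->
  set_surj setT setT h -> (forall x y, R (x, y) <-> S (h x, h y)) ->
  isomorphism R S h.
Proof.
move=> cR hY ch hI hs hm; split => //; split => // [|x y /hm //].
have [[hX tR clR] cX] := cR.
have [g [hK gK _]] := compact_bij_inv cX hY ch hI hs.
have RS x y : S (x, y) <-> R (g x, g y) by rewrite hm !gK.
split; [split => //|].
- have -> : S = [set p | R (g p.1, g p.2)] by apply/seteqP; split => -[x y] /RS.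
  apply: (tournament_inj tR (f := g)); last exact: can_inj gK.
  by case: tR => -[x _] _ _; exists (h x).
- have -> : S = (fun p => (h p.1, h p.2)) @` R.
    apply/seteqP; split => [[x y] /RS|_ [[x y] /hm /= ? <-] //].
    by exists (g x, g y) => //=; rewrite !gK.
  apply: compact_closed; first exact: hausdorff_prod.
  apply: continuous_image_compact; first exact: continuous_pair.
  apply: (subclosed_compact clR (compact_setX cX cX)) => //.
- have -> : [set: Y] = h @` [set: X].
    by apply/seteqP; split => [y _|//]; exact: hs.
  exact: continuous_image_compact.
Qed.

(** The inverse preserves arcs because a bijective morphism of tournaments
    cannot lose one: the reversed arc would be preserved too. *)
Lemma isomorphism_inverse (X Y : topologicalType) (R : set (X * X))
    (S : set (Y * Y)) h :
  isomorphism R S h ->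
  exists g, [/\ isomorphism S R g, cancel h g & cancel g h].
Proof.
move=> [[cR cS ch hs hm] hI].
have [[hX tR _] cX] := cR; have [[hY tS _] cY] := cS.
have [g [hK gK cg]] := compact_bij_inv cX hY ch hI hs.
exists g; split => //; split; last exact: can_inj gK.
split => // [x _|x y xy]; first by exists (h x).
have [//|/hm] := tournament_total tR (g x) (g y).
rewrite !gK => /(tournament_anti tS xy) ->; exact: tournament_refl.
Qed.

(** * Convex sets and prime tournaments *)

Lemma trivialP (X : Type) (x : X) : trivial X <-> forall y, y = x.
Proof.
split=> [/card_set_bijP[f [ff fI _]] y|xP].
  have f0 z : f z = 0%N by move: (ff z I) => /=; case: (f z).
  by apply: fI; rewrite ?inE // !f0.
rewrite /trivial.
have -> : [set: X] = [set x] by apply/seteqP; split => // y _; exact: xP.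
exact: card_set1.
Qed.

Lemma two_pointsP (X : Type) : two_points X ->
  exists x y : X, x <> y /\ forall z, z = x \/ z = y.
Proof.
move=> /card_set_bijP[f [ff fI fs]].
have [//|x _ fx] := fs 0%N; have [//|y _ fy] := fs 1%N.
exists x, y; split=> [xy|z]; first by move: fx; rewrite xy fy.
have : (f z < 2)%N by exact: ff.
case fz : (f z) => [|[|]] // _; [left|right]; apply: fI; rewrite ?inE //.
- by rewrite fz.
- by rewrite fz.
Qed.

Lemma nontrivial (X : Type) (x y : X) : x <> y -> ~ trivial X.
Proof. by move=> xy /(trivialP y)/(_ x). Qed.

(** Betweenness in a tournament: c lies between a and b when a -> c -> b. *)
Definition arc_convex (X : Type) (R : set (X * X)) (C : set X) : Prop :=
  forall a b c, C a -> C b -> strict_part R (a, c) -> strict_part R (c, b) ->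
  C c.

(** If h a = h b, an intermediate c gives arcs in both directions between h a
    and h c, so antisymmetry forces h c = h a. *)
Lemma fiber_convex (X Y : topologicalType) (R : set (X * X)) (S : set (Y * Y)) h
  (y : Y) : quotient_map R S h -> arc_convex R (h @^-1` [set y]).
Proof.
move=> [_ [[_ tS _] _] _ _ hm] a b c /= ay by_ [ac _] [cb _].
by apply: (tournament_anti tS); [rewrite -by_|rewrite -ay]; exact: hm.
Qed.

Lemma fiber_closed (X Y : topologicalType) (R : set (X * X)) (S : set (Y * Y)) h
  (y : Y) : quotient_map R S h -> closed (h @^-1` [set y]).
Proof.
move=> [_ [[hY _ _] _] ch _ _]; apply: preimage_closed => [x _|].
  exact: ch.
exact: hausdorff_closed1.
Qed.

Lemma prime_of_convex (X : topologicalType) (R : set (X * X)) :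
  compact_tournament R -> ~ trivial X ->
  (forall C, closed C -> arc_convex R C ->
     forall a b, C a -> C b -> a <> b -> C = setT) ->
  prime_tournament R.
Proof.
move=> cR X1 RC; split => // Y S h Y1 hq; split => // a b hab.
apply: contrapT => ab; apply: Y1.
have CT : h @^-1` [set h b] = setT.
  by apply: (RC _ _ _ a b) => //;
    [exact: fiber_closed hq|exact: fiber_convex hq].
apply/(trivialP (h b)) => y; have [_ _ _ hs _] := hq.
have [//|x _ <-] := hs y.
by have : setT x by []; rewrite -CT.
Qed.

Lemma prime_inv (X : topologicalType) (R : set (X * X)) :
  prime_tournament R -> prime_tournament (R^-1)%relation.
Proof.
move=> [cR X1 RP]; split => //; first exact: compact_tournament_inv.
move=> Y S h Y1 hq; split => //.
have := quotient_map_inv hq.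
rewrite (_ : (R^-1)^-1%relation = R); last by apply/seteqP; split=> -[].
by move=> /(RP _ _ h Y1)[].
Qed.

Lemma prime_isomorphism (X Y : topologicalType) (R : set (X * X))
    (S : set (Y * Y)) h :
  isomorphism R S h -> prime_tournament R -> prime_tournament S.
Proof.
move=> [hq hI] [_ X1 RP]; have [_ cS _ hs _] := hq; split => //.
  move=> Y1; apply: X1.
  have [[_ [[x _] _ _] _] _] : compact_tournament R by case: hq.
  by apply/(trivialP x) => y; apply: hI; exact: (iffLR (trivialP (h x)) Y1).
move=> Z T q Z1 qq; split => //.
have [_ qhI] := RP _ _ _ Z1 (quotient_map_comp hq qq).
move=> y z; have [//|x _ <-] := hs y; have [//|w _ <-] := hs z.
by move=> /qhI ->.
Qed.

(** * Tournaments without a quotient onto an arc *)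

Lemma has_arc_quotient_comp (X Y : topologicalType) (R : set (X * X))
    (S : set (Y * Y)) h :
  quotient_map R S h -> has_arc_quotient S -> has_arc_quotient R.
Proof.
move=> hq [Z [T [q [Z2 qq]]]]; exists Z, T, (q \o h); split => //.
exact: quotient_map_comp hq qq.
Qed.

(** Among three points of a 3-cycle two have the same image in an arc, and then
    convexity of the fibers puts the third one with them: a fiber is a closed set
    that contains every 3-cycle it meets. *)
Lemma no_arc_quotient (X : topologicalType) (R : set (X * X)) (p : X) :
  (forall C, closed C -> C p ->
     (forall a b c, cycle3 R a b c -> C a -> C b) -> C = setT) ->
  ~ has_arc_quotient R.
Proof.
move=> RC [Y [S [q [Y2 qq]]]].
have [x [y [xy yP]]] := two_pointsP Y2.
have [_ _ _ qs _] := qq.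
have qc z := fiber_convex (y := z) qq.
have CT : q @^-1` [set q p] = setT.
  apply: RC => //; first exact: fiber_closed qq.
  move=> a b c [ab bc ca] /= <-.
  have [//|ba] := pselect (q b = q a).
  have [cb|cb] : q c = q b \/ q c = q a.
  + by case: (yP (q a)) (yP (q b)) (yP (q c)) ba => -> [] -> [] -> //; auto.
  + by have := qc (q b) c b a; rewrite /= => /(_ cb erefl ca ab) ->.
  + by have := qc (q a) a c b; rewrite /= => /(_ erefl cb ab bc) ->.
have qE z : q z = q p by have : setT z by []; rewrite -CT.
by apply: xy; have [//|u _ <-] := qs x; have [//|v _ <-] := qs y; rewrite !qE.
Qed.

Lemma arc_cyclic_no_arc_quotient (X : topologicalType) (R : set (X * X)) :
  is_tournament R -> arc_cyclic R -> ~ has_arc_quotient R.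
Proof.
move=> tR aR; have [[p _] _ _] := tR.
apply: (no_arc_quotient (p := p)) => C _ Cp Cc.
apply/seteqP; split => // z _.
have [->//|/aR[w [zp pw wz]]|/aR] := tournament_trichotomy tR z p.
- have Cw : C w by apply: (Cc p w z) => //; split.
  by apply: (Cc w z p) => //; split.
- by move=> [w pzw]; exact: Cc pzw Cp.
Qed.

(** * Digits of 2-adic integers *)

Definition lead_at (n : nat) (u : Z2) : Prop :=
  (forall j, (j < n)%N -> u j = false) /\ u n = true.

Definition differ_at (n : nat) (x y : Z2) : Prop :=
  (forall j, (j < n)%N -> x j = y j) /\ x n <> y n.

Lemma Z2_zeroE n : (0 : Z2) n = false.
Proof. by []. Qed.

Lemma lead_differ n u : lead_at n u <-> differ_at n 0 u.
Proof.
split=> -[u0 un]; split=> [j jn|]; first by rewrite u0.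
- by rewrite un.
- by rewrite -u0.
- by move: un; rewrite Z2_zeroE; case: (u n).
Qed.

Lemma differ_exists x y : x <> y -> exists n, differ_at n x y.
Proof.
move=> xy; have : exists n, x n != y n.
  by apply: contra_notP xy => xy; apply/funext => n; apply/eqP;
     apply: contrapT => xyn; apply: xy; exists n; exact/negP.
move=> ex; case: (ex_minnP ex) => n /eqP xyn nmin; exists n; split => // j jn.
by apply/eqP; apply: contraLR jn => /nmin; rewrite -leqNgt.
Qed.

Lemma differ_uniq n m x y : differ_at n x y -> differ_at m x y -> n = m.
Proof.
move=> [xn nn] [xm mm]; apply/eqP; rewrite eqn_leq.
by apply/andP; split; rewrite leqNgt; apply/negP; [move/xn/mm|move/xm/nn].
Qed.

Lemma lead_exists u : u <> 0 -> exists n, lead_at n u.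
Proof.
by move=> u0; have [n /lead_differ ?] := differ_exists (nesym u0); exists n.
Qed.

Lemma lead_uniq n m u : lead_at n u -> lead_at m u -> n = m.
Proof. by move=> /lead_differ nu /lead_differ; exact: differ_uniq. Qed.

Lemma lead_neq0 n u : lead_at n u -> u <> 0.
Proof. by move=> [_ un] u0; move: un; rewrite u0. Qed.

Lemma differ_sym n x y : differ_at n x y -> differ_at n y x.
Proof. by move=> [xy nxy]; split=> [j /xy|/esym]. Qed.

Lemma carry0 (d x : Z2) n :
  (forall j, (j < n)%N -> d j = false) -> Z2_carry d x n = false.
Proof.
elim: n => //= n IH d0; rewrite d0 //= IH // => j jn; apply: d0.
exact: ltnW.
Qed.

Lemma subK_digit (x y : Z2) n :
  y n = (y - x) n (+) x n (+) Z2_carry (y - x) x n.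
Proof. by rewrite -Z2_addE subrK. Qed.

Lemma sub_agree (x y : Z2) n : (forall j, (j < n)%N -> x j = y j) ->
  forall j, (j < n)%N -> (y - x) j = false.
Proof.
move=> xy; elim/ltn_ind => j IH jn.
have := subK_digit x y j.
rewrite carry0; last by move=> i ij; apply: IH => //; exact: ltn_trans jn.
by rewrite xy // addbF; case: ((y - x) j) (y j) => -[].
Qed.

Lemma lead_sub n (x y : Z2) : differ_at n x y -> lead_at n (y - x).
Proof.
move=> [xy nxy]; have d0 := sub_agree xy; split => //.
have := subK_digit x y n; rewrite carry0 // addbF.
by case: ((y - x) n) (x n) (y n) nxy => -[] [].
Qed.

(** A borrow reaches digit n+1 exactly when x n is the larger of the two
    differing digits. *)
Lemma sub_next n (x y : Z2) : differ_at n x y ->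
  (y - x) n.+1 = x n.+1 (+) y n.+1 (+) x n.
Proof.
move=> xy; have [d0 dn] := lead_sub xy.
have := subK_digit x y n.+1; rewrite /= carry0 // dn /= orbF.
by case: ((y - x) n.+1) (x n) (x n.+1) (y n.+1) => -[] [] [].
Qed.

Lemma differ_sub n (x y : Z2) : lead_at n (y - x) -> differ_at n x y.
Proof.
move=> nl; have xy : x <> y.
  by move=> xy; apply: (lead_neq0 nl); rewrite xy subrr.
have [m mxy] := differ_exists xy.
by rewrite (lead_uniq nl (lead_sub mxy)).
Qed.

(** The digit form of an arc of Ahat; n is the position of the leading 1 of
    y - x. *)
Definition arc_at (n : nat) (x y : Z2) : Prop :=
  differ_at n x y /\ x n.+1 (+) y n.+1 = x n.

(** For e = 0 this is Aset, and for e = 1 it is the set of its opposites: the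
    two are separated by the digit behind the leading 1. *)
Definition cone (e : bool) : set Z2 :=
  [set u | forall n, lead_at n u -> u n.+1 = e].

Lemma Aset_cone : Aset = cone false.
Proof.
apply/seteqP; split=> [u [->|[n _ [u0 un un1]]] m um|u cu].
- by [].
- by rewrite -(lead_uniq (conj u0 un) um).
- have [->|/lead_exists[n nu]] := pselect (u = 0); first by left.
  by right; exists n => //; have [? ?] := nu; split => //; exact: cu.
Qed.

Lemma Ahat_arc x y : Ahat (x, y) <-> x = y \/ exists n, arc_at n x y.
Proof.
rewrite /Ahat /= Aset_cone; split=> [xy|[->|[n [nxy xy]] m /differ_sub mxy]].
- have [->|/differ_exists[n nxy]] := pselect (x = y); [by left|right].
  exists n; split => //; have := xy n (lead_sub nxy).
  by rewrite (sub_next nxy); case: (x n) (x n.+1) (y n.+1) => -[] [].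
- by move=> n nl; case: (lead_neq0 nl); rewrite subrr.
- by rewrite -(differ_uniq nxy mxy) (sub_next nxy) xy addbb.
Qed.

Lemma strict_Ahat x y : strict_part Ahat (x, y) <-> exists n, arc_at n x y.
Proof.
rewrite strictE Ahat_arc; split=> [[[//|//]]|[n nxy]].
by split; [right; exists n|case: nxy => -[_ xyn] _ xy; apply: xyn; rewrite xy].
Qed.

Lemma arc_total n x y : differ_at n x y -> arc_at n x y \/ arc_at n y x.
Proof.
move=> nxy; have [_ xyn] := nxy.
have [?|xy] := pselect (x n.+1 (+) y n.+1 = x n); first by left.
right; split; first exact: differ_sym.
by case: (x n) (y n) (x n.+1) (y n.+1) xyn xy => -[] [] [].
Qed.

Lemma arc_asym n m x y : arc_at n x y -> arc_at m y x -> False.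
Proof.
move=> [nxy xy] [/differ_sym mxy yx]; move: yx.
rewrite -(differ_uniq nxy mxy); case: nxy => _.
by move: xy; case: (x n) (y n) (x n.+1) (y n.+1) => -[] [] [].
Qed.

Lemma Ahat_tournament : is_tournament Ahat.
Proof.
apply: tournament_intro; first by exists 0.
- by move=> x; apply/Ahat_arc; left.
- move=> x y /Ahat_arc[//|[n xy]] /Ahat_arc[//|[m yx]].
  by case: (arc_asym xy yx).
- move=> x y; have [->|/differ_exists[n /arc_total]] := pselect (x = y).
    by left; apply/Ahat_arc; left.
  by case=> ?; [left|right]; apply/Ahat_arc; right; exists n.
Qed.

Lemma arc_exists n x : exists y, arc_at n x y.
Proof.
exists (fun k => if k == n then ~~ x n else
                 if k == n.+1 then x n.+1 (+) x n else x k).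
split; last by rewrite gtn_eqF // eqxx; case: (x n) (x n.+1) => -[].
split=> [j jn|]; first by rewrite !ltn_eqF // ltnW.
by rewrite eqxx; case: (x n).
Qed.

(** The third point is y with digit n+1 flipped, so that it still differs from
    x first at n; digit n+2 then directs the arc from y to it. *)
Lemma arc_cycle n x y : arc_at n x y ->
  exists z, arc_at n.+1 y z /\ arc_at n z x.
Proof.
move=> [[xy nxy] e].
pose z : Z2 := fun k => if k == n.+1 then ~~ y k else
                        if k == n.+2 then y n.+2 (+) y n.+1 else y k.
have zy j : (j < n.+1)%N -> z j = y j.
  by move=> jn; rewrite /z !ltn_eqF // ltnW.
have zn : z n.+1 = ~~ y n.+1 by rewrite /z eqxx.
exists z; split; split.
- by split=> [j /zy|]; rewrite ?zn //; case: (y n.+1).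
- by rewrite /z gtn_eqF // eqxx; case: (y n.+1) (y n.+2) => -[].
- split=> [j jn|]; rewrite zy //; first by rewrite xy.
    exact: ltnW.
  exact: nesym.
- rewrite zn zy //.
  by move: nxy e; case: (x n) (y n) (x n.+1) (y n.+1) => -[] [] [].
Qed.

(** This lemma and the next order the levels of the out-set of x: level
    n points to level n+1, and every level beyond n+1 points to level n. *)
Lemma arc_succ n x y z : arc_at n x y -> arc_at n.+1 x z -> arc_at n y z.
Proof.
move=> [[xy nxy] e] [[xz nxz] _]; split; [split|].
- by move=> j jn; rewrite -xy // xz // ltnW.
- by rewrite -xz //; exact: nesym.
- move: nxy nxz e.
  by case: (x n) (y n) (x n.+1) (y n.+1) (z n.+1) => -[] [] [] [].
Qed.

Lemma arc_far n m x y z : (n.+1 < m)%N ->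
  arc_at n x y -> arc_at m x z -> arc_at n z y.
Proof.
move=> nm [[xy nxy] e] [[xz _] _].
split; first split=> [j jn|]; rewrite -?xz //.
- exact: xy.
- by apply: ltn_trans nm; apply: ltnW.
- exact: ltnW.
- exact: ltnW.
Qed.

Lemma Ahat_cycle n x y : arc_at n x y -> exists z,
  cycle3 Ahat x y z /\ forall j, (j < n)%N -> x j = z j.
Proof.
move=> xy; have [z [yz zx]] := arc_cycle xy; exists z; split.
  by split; apply/strict_Ahat; [exists n|exists n.+1|exists n].
by move=> j jn; case: zx => -[zx _] _; rewrite zx.
Qed.

Lemma Ahat_arc_cyclic : arc_cyclic Ahat.
Proof. by move=> x y /strict_Ahat[n /Ahat_cycle[z [xyz _]]]; exists z. Qed.

(** * Topology of the 2-adic integers *)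

Lemma Z2_near_prefix (x : Z2) n :
  \forall y \near x, forall j, (j < n)%N -> y j = x j.
Proof.
elim: n => [|n IH]; first exact: filterE.
apply: filterS2 IH (Z2_near_coord x n) => y yx yxn j; rewrite ltnS leq_eqVlt.
by case/predU1P => [->|/yx].
Qed.

(** The prefix sets of x form a filter base that converges to x coordinatewise. *)
Lemma Z2_nbhs_prefix (x : Z2) (U : set Z2) : nbhs x U ->
  exists n, forall y : Z2, (forall j, (j < n)%N -> y j = x j) -> U y.
Proof.
pose B n : set Z2 := [set y | forall j, (j < n)%N -> y j = x j].
pose F := filter_from [set: nat] B.
have FF : Filter F.
  apply: filter_from_filter => [|i j _ _]; first by exists 0%N.
  by exists (maxn i j) => // y yx; split=> k ki; apply: yx;
    rewrite leq_max ki ?orbT.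
suff Fx : F --> x by move=> /Fx[n _ BU]; exists n => y; exact: BU.
apply/cvg_sup => n V [_ [[W _ <-] Wx] sWV]; exists n.+1 => // y yx.
by apply: sWV; rewrite /= yx.
Qed.

Lemma Z2_hausdorff : hausdorff_space Z2.
Proof. exact: cantor_space_hausdorff. Qed.

Lemma Z2_compact : compact [set: Z2].
Proof. exact: cantor_space_compact. Qed.

Lemma Ahat_closed : closed Ahat.
Proof.
rewrite -[Ahat]setCK; apply: open_closedC; rewrite openE => -[x y] nxy.
have [xy|/differ_exists[n xy]] := pselect (x = y).
  by case: nxy; rewrite xy; apply: tournament_refl; exact: Ahat_tournament.
have [xy'|yx] := arc_total xy.
  by case: nxy; apply/Ahat_arc; right; exists n.
exists ([set u | forall j, (j < n.+2)%N -> u j = x j],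
        [set v | forall j, (j < n.+2)%N -> v j = y j]).
  by split; exact: Z2_near_prefix.
move=> [u v] [/= ux vy] /Ahat_arc.
have vu : arc_at n v u.
  have [[yx0 nyx] e] := yx.
  split; [split|]; rewrite ?ux ?vy //; try exact: ltnW.
  by move=> j jn; rewrite ux ?vy ?yx0 // ltnW // ltnW.
case=> [uv|[m uv]]; last exact: (arc_asym vu uv).
by case: vu => -[_ +] _; rewrite uv.
Qed.

Lemma Ahat_compact : compact_tournament Ahat.
Proof.
split; last exact: Z2_compact.
by split; [exact: Z2_hausdorff|exact: Ahat_tournament|exact: Ahat_closed].
Qed.

Lemma Z2_cantor : cantor_set Z2.
Proof. by exists id, id; split => // x; exact: cvg_id. Qed.

(** The cycles of [arc_cycle] keep the common prefix, so those through arcs of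
    large level are small. *)
Lemma Ahat_cycle_point x : cycle_point Ahat x.
Proof.
move=> U /Z2_nbhs_prefix[n nU]; have [y xy] := arc_exists n x.
have [z [xyz xz]] := Ahat_cycle xy; exists y, z; split => //; apply: nU => j jn.
  by case: xy => -[xy _] _; rewrite xy.
by rewrite xz.
Qed.

Lemma Ahat_nontrivial : ~ trivial Z2.
Proof.
have [y [[_ xy] _]] := arc_exists 0 0.
by apply: (@nontrivial _ y 0) => e; apply: xy; rewrite e.
Qed.

(** * Primality *)

Lemma Ahat_prime : prime_tournament Ahat.
Proof.
apply: (prime_of_convex Ahat_compact Ahat_nontrivial) => C _ cC a b Ca Cb ab.
wlog {ab} [n ab] : a b Ca Cb / exists n, arc_at n a b.
  move=> H; have [//|/strict_Ahat|/strict_Ahat] :=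
    tournament_trichotomy Ahat_tournament a b; [exact: H|exact: H].
(* level m is reached from the far levels by descending one level at a time *)
have out m : forall c, arc_at m a c -> C c.
  have far c k : (n.+1 < k)%N -> arc_at k a c -> C c.
    move=> nk ac; apply: (cC a b) => //; apply/strict_Ahat; first by exists k.
    by exists n; exact: arc_far ac.
  have down k : (forall c, arc_at k.+1 a c -> C c) ->
      forall c, arc_at k a c -> C c.
    move=> H c ac; have [d ad] := arc_exists k.+1 a.
    apply: (cC a d) => //; [exact: H|by apply/strict_Ahat; exists k|].
    by apply/strict_Ahat; exists k; exact: arc_succ ac ad.
  have : forall k, (forall c, arc_at (m + k) a c -> C c) ->
      forall c, arc_at m a c -> C c.
    by elim=> [|k IH]; [rewrite addn0|rewrite addnS => /down].
  by move=> H; apply: (H n.+2) => c; exact: far (leq_addl _ _).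
apply/seteqP; split => // c _.
have [<-//|/strict_Ahat[m /out//]|ca] :=
  tournament_trichotomy Ahat_tournament a c.
have [d [_ ad dc]] := Ahat_arc_cyclic ca.
by apply: (cC d a) => //; have /strict_Ahat[m /out] := ad.
Qed.

(** * Negation and shifts *)

Lemma Ahat_translate (z x y : Z2) : Ahat (x + z, y + z) <-> Ahat (x, y).
Proof. by rewrite /Ahat /= opprD addrACA subrr addr0. Qed.

Lemma Ahat_opp (x y : Z2) : Ahat (- x, - y) <-> Ahat (y, x).
Proof. by rewrite /Ahat /= opprK addrC. Qed.

Lemma opp_homeomorphism : homeomorphism (fun x : Z2 => - x : Z2).
Proof.
by exists (fun x : Z2 => - x); split; try exact: opprK; exact: Z2_opp_continuous.
Qed.

Lemma opp_isomorphism :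
  isomorphism Ahat (Ahat^-1)%relation (fun x : Z2 => - x : Z2).
Proof.
apply: isomorphism_intro; first exact: Ahat_compact.
- exact: Z2_hausdorff.
- exact: Z2_opp_continuous.
- exact: oppr_inj.
- by move=> y _; exists (- y) => //; exact: opprK.
- by move=> x y; rewrite /= Ahat_opp.
Qed.

Lemma iter_shift k (x : Z2) n : iter k Z2_shift x n = x (k + n)%N.
Proof. by elim: k n => // k IH n; rewrite iterS /Z2_shift IH addnS. Qed.

Lemma shift_continuous k : continuous (iter k Z2_shift : Z2 -> Z2).
Proof.
move=> x; apply: Z2_cvg => n; apply: filterS (Z2_near_coord x (k + n)) => y yx.
exact: etrans (iter_shift k y n) (etrans yx (esym (iter_shift k x n))).
Qed.

Lemma shift_inj k x y : (forall j, (j < k)%N -> x j = y j) ->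
  iter k Z2_shift x = iter k Z2_shift y -> x = y.
Proof.
move=> xy e; apply/funext => n; have [|kn] := ltnP n k; first exact: xy.
by rewrite -(subnKC kn) -!iter_shift e.
Qed.

Lemma shift_arc k n x y : (forall j, (j < k)%N -> x j = y j) ->
  arc_at (k + n) x y <-> arc_at n (iter k Z2_shift x) (iter k Z2_shift y).
Proof.
move=> xy; rewrite /arc_at /differ_at !iter_shift addnS.
split=> -[[xyn nxy] e]; do 2!split => //.
  by move=> j jn; rewrite !iter_shift; apply: xyn; rewrite ltn_add2l.
move=> j; have [/xy //|kj] := ltnP j k.
by rewrite -(subnKC kj) ltn_add2l => /xyn; rewrite !iter_shift.
Qed.

(** A common prefix moves the first difference, and nothing else in [arc_at]. *)
Lemma shift_Ahat k x y : (forall j, (j < k)%N -> x j = y j) ->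
  Ahat (x, y) <-> Ahat (iter k Z2_shift x, iter k Z2_shift y).
Proof.
move=> xy; rewrite !Ahat_arc; split=> -[e|[n nxy]].
- by left; rewrite e.
- right; have kn : (k <= n)%N.
    by rewrite leqNgt; apply/negP => /xy; case: nxy => -[].
  by exists (n - k)%N; apply/shift_arc => //; rewrite subnKC.
- by left; exact: shift_inj e.
- by right; exists (k + n)%N; apply/shift_arc.
Qed.

Definition prepend k (w : nat -> bool) (z : Z2) : Z2 :=
  fun n => if (n < k)%N then w n else z (n - k)%N.

Lemma shift_prepend k w z : iter k Z2_shift (prepend k w z) = z.
Proof.
by apply/funext => n; rewrite iter_shift /prepend ltnNge leq_addr /= addKn.
Qed.

Lemma cylinder_closed k (w : k.-tuple bool) : closed (cylinder w).
Proof.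
rewrite -[cylinder w]setCK; apply: open_closedC; rewrite openE => x xw.
apply: filterS (Z2_near_prefix x k) => y yx yw; apply: xw => i.
by rewrite -yx // yw.
Qed.

Lemma shift_isomorphism k (w : k.-tuple bool) :
  isomorphism (restr_rel Ahat (cylinder w)) Ahat
    (fun y : cylinder w => iter k Z2_shift (set_val y)).
Proof.
have agree (x y : cylinder w) j : (j < k)%N -> set_val x j = set_val y j.
  move=> jk; have xw := set_valP x; have yw := set_valP y.
  exact: etrans (xw (Ordinal jk)) (esym (yw (Ordinal jk))).
have mem z : cylinder w (prepend k (nth false w) z).
  by move=> i; rewrite /prepend ltn_ord (tnth_nth false).
apply: isomorphism_intro.
- apply: restr_compact_tournament; [exact: Ahat_compact|exact: cylinder_closed|].
  by exists (prepend k (nth false w) 0); exact: mem.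
- exact: Z2_hausdorff.
- move=> x; apply: continuous_comp; first exact: set_val_continuous.
  exact: shift_continuous.
- by move=> x y /shift_inj xy; apply/(@set_val_inj _ (cylinder w))/xy/agree.
- move=> z _; exists (set_elt (mem z)) => //.
  by rewrite set_eltE shift_prepend.
- by move=> x y; apply: shift_Ahat; exact: agree.
Qed.

(** * The one-point compactification of the natural numbers *)

(** The tails of an unbounded set generate a filter without cluster point. *)
Lemma nat_compact_bounded (C : set nat) :
  compact C -> exists N, forall n, C n -> (n < N)%N.
Proof.
move=> cC; apply: contrapT => unb.
pose B N := C `&` [set n | (N <= n)%N].
pose F := filter_from [set: nat] B.
have FF : ProperFilter F.
  apply: filter_from_proper.
    apply: filter_from_filter => [|i j _ _]; first by exists 0%N.
    by exists (maxn i j) => // n [Cn /=]; rewrite geq_max => /andP[? ?].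
  move=> N _; apply: contrapT => BN; apply: unb; exists N => n Cn.
  by rewrite ltnNge; apply/negP => Nn; apply: BN; exists n.
have [|p [_ clp]] := cC F FF; first by exists 0%N => // n [].
have [|m [[_ /= pm] mp]] := clp (B p.+1) [set p] _ (discrete_set1 p).
  by exists p.+1.
by rewrite mp ltnn in pm.
Qed.

Lemma nat_locally_compact : locally_compact [set: nat].
Proof.
move=> n _; exists [set n]; first by rewrite withinET; exact: discrete_set1.
by split; [exact: compact_set1|exact: discrete_closed].
Qed.

Lemma Nstar_hausdorff : hausdorff_space Nstar.
Proof.
apply: one_point_compactification_hausdorff; first exact: nat_locally_compact.
exact: discrete_hausdorff.
Qed.

Lemma Nstar_compact : compact [set: Nstar].
Proof. exact: one_point_compactification_compact. Qed.

Lemma Nstar_nbhs_some i : nbhs (Some i : Nstar) [set Some i].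
Proof.
have -> : [set Some i : Nstar] = Some @` [set i].
  by apply/seteqP; split => [_ ->|_ [_ -> <-]]; [exists i|].
apply: one_point_compactification_some_nbhs; exact: discrete_set1.
Qed.

Lemma Nstar_nbhs_none (U : set Nstar) :
  nbhs (None : Nstar) U <->
  U None /\ exists N, forall n, (N <= n)%N -> U (Some n).
Proof.
split=> [[C [cC _] CU]|[U0 [N NU]]].
  split; first by apply: CU; right.
  have [N CN] := nat_compact_bounded cC; exists N => n Nn; apply: CU; left.
  by exists n => // /CN; rewrite ltnNge Nn.
exists `I_N.
  by split; [apply: finite_compact; exact: finite_II|exact: discrete_closed].
move=> [n|//] [[m /= mN [<-]]|//]; apply: NU.
by rewrite leqNgt; exact/negP.
Qed.

Lemma Nstar_isolated i : isolated [set: Nstar] (Some i).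
Proof.
split; first by rewrite inE.
by exists [set Some i]; [exact: Nstar_nbhs_some|exact: setIT].
Qed.

Lemma Nstar_not_isolated : ~ isolated [set: Nstar] None.
Proof.
move=> [_ [V /Nstar_nbhs_none[_ [N VN]]]]; rewrite setIT => VE.
by have := VN N (leqnn N); rewrite VE.
Qed.

(** * The tournaments on the index space *)

(** One index tournament for each cone, selected by the same digit. *)
Definition Ltour (e : bool) : set (Nstar * Nstar) :=
  if e then L1 else (L1^-1)%relation.

Lemma L1_tournament : is_tournament L1.
Proof.
apply: tournament_intro; first by exists None.
- by case=> [n|]; rewrite /L1 //= eqxx.
- by case=> [n|] [m|] //; rewrite /L1 /= => ? ?; congr Some; lia.
- by case=> [n|] [m|]; rewrite /L1 //=; try (by left); try (by right); lia.
Qed.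

Lemma L1_closed : closed L1.
Proof.
rewrite -[L1]setCK; apply: open_closedC; rewrite openE => -[[i|] [j|]] nL //.
- exists ([set Some i], [set Some j]); first by split; exact: Nstar_nbhs_some.
  by move=> [a b] [/= -> ->].
- by case: nL.
- exists ([set a | if a is Some k then (j.+1 < k)%N else True], [set Some j]).
    split; last exact: Nstar_nbhs_some.
    by apply/Nstar_nbhs_none; split => //; exists j.+2.
  move=> [[k|] b] [/= ka ->]; rewrite /L1 //=; lia.
- by case: nL.
Qed.

Lemma Ltour_compact e : compact_tournament (Ltour e).
Proof.
have cL : compact_tournament L1.
  split; last exact: Nstar_compact.
  by split; [exact: Nstar_hausdorff|exact: L1_tournament|exact: L1_closed].
by case: e => //; exact: compact_tournament_inv.
Qed.

(** Two elements of a closed convex set always lead to a pair n, n+1 in it: if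
    i -> j with i < j < oo then j+1 lies between them, and i+2 lies between i and
    oo.  Such a pair spreads to n-1 and to n+2, hence to all finite indices, and
    to oo by closedness. *)
Lemma L1_prime : prime_tournament L1.
Proof.
apply: (prime_of_convex (Ltour_compact true)).
  exact: (@nontrivial _ (Some 0%N : Nstar) None).
move=> C clC cC.
have conv (a b c : Nstar) : C a -> C b -> L1 (a, c) -> L1 (c, b) -> a <> c ->
    c <> b -> C c by move=> Ca Cb ac cb ? ?; apply: (cC a b).
(* upwards by n -> n+2 -> n+1, and downwards by n+1 -> n -> n+2 *)
have up n : C (Some n) -> C (Some n.+1) -> C (Some n.+2).
  by move=> ? ?; apply: (conv (Some n) (Some n.+1)) => //;
    rewrite /L1 /=; try lia; case; lia.
have down n : C (Some n.+1) -> C (Some n.+2) -> C (Some n).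
  by move=> ? ?; apply: (conv (Some n.+1) (Some n.+2)) => //;
    rewrite /L1 /=; try lia; case; lia.
have all n : C (Some n) -> C (Some n.+1) -> C = setT.
  move=> Cn CSn.
  have ge k : C (Some (n + k)%N) /\ C (Some (n + k).+1).
    elim: k => [|k [? ?]]; first by rewrite addn0.
    by rewrite addnS; split => //; exact: up.
  have le k : (k <= n)%N -> C (Some (n - k)%N) /\ C (Some (n - k).+1).
    elim: k => [|k IH] kn; first by rewrite subn0.
    have [] := IH (ltnW kn).
    have -> : (n - k = (n - k.+1).+1)%N by lia.
    by move=> ? ?; split => //; exact: down.
  have fin k : C (Some k).
    have [kn|nk] := leqP k n.
      by have [] := le _ (leq_subr k n); rewrite subKn.
    by have [] := ge (k - n)%N; rewrite subnKC // ltnW.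
  apply/seteqP; split => // -[k|] _ //; apply: clC => U.
  by move=> /Nstar_nbhs_none[_ [N NU]]; exists (Some N); split => //; exact: NU.
have fin i j : (i < j)%N -> C (Some i) -> C (Some j) -> C = setT.
  move=> ij Ci Cj; have [ji|ji] := eqVneq j i.+1.
    by apply: (all i); rewrite -?ji.
  apply: (all j) => //; apply: (conv (Some i) (Some j)) => //;
    rewrite /L1 /=; try lia; case; lia.
have inf i : C (Some i) -> C None -> C = setT.
  move=> Ci C0; apply: (@fin i i.+2) => //; apply: (conv (Some i) None) => //;
    rewrite /L1 /=; try lia; case; lia.
move=> [i|] [j|] Ci Cj ij //.
- have [ltij|] := ltnP i j; first exact: (fin i j).
  rewrite leq_eqVlt => /predU1P[ji|/fin]; last exact.
  by case: ij; rewrite ji.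
- exact: (inf i).
- exact: (inf j).
Qed.

Lemma Ltour_prime e : prime_tournament (Ltour e).
Proof. by case: e; [exact: L1_prime|exact/prime_inv/L1_prime]. Qed.

Lemma Ltour_lt e i j : (i < j)%N ->
  (Ltour e (Some i, Some j) <-> e (+) (j == i.+1)) /\
  (Ltour e (Some j, Some i) <-> ~~ (e (+) (j == i.+1))).
Proof. by move=> ij; case: e; rewrite /Ltour /L1 /=; split; split; lia. Qed.

Lemma Ltour_none e i :
  (Ltour e (Some i, None) <-> e) /\ (Ltour e (None, Some i) <-> ~~ e).
Proof. by case: e. Qed.

(** * The lexicographic product *)

Lemma lexprod_nbhsP (X : topologicalType) (Y : X -> topologicalType)
    (u : lexprod Y) (U : set (lexprod Y)) :
  nbhs u U <-> exists B, [/\ lexprod_base B, B u & B `<=` U].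
Proof.
split=> [|[B [bB Bu BU]]].
  rewrite nbhsE => -[W [[D DB <-] [B DBB Bu]] WU].
  by exists B; split; [exact: DB|exact: Bu|move=> v Bv; apply: WU; exists B].
rewrite nbhsE; exists B => //; split => //.
by exists [set B]; [move=> C ->|exact: bigcup_set1].
Qed.

Lemma lexprod_proj_continuous (X : topologicalType) (Y : X -> topologicalType) :
  continuous (@lexprod_proj X Y).
Proof.
move=> u V; rewrite nbhsE => -[W [oW Wu] WV]; apply/lexprod_nbhsP.
exists (@lexprod_proj X Y @^-1` W); split => //; last by move=> v /WV.
by left; exists W.
Qed.

(** Only the fibers over isolated points embed: over other points the product
    topology restricts to the indiscrete one. *)
Lemma lexprod_fiber_continuous (X : topologicalType) (Y : X -> topologicalType)
    (x : X) : isolated [set: X] x -> continuous (existT Y x : Y x -> lexprod Y).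
Proof.
move=> ix y U nU; rewrite /nbhs /=; change (nbhs y (existT Y x @^-1` U)).
move: nU => /lexprod_nbhsP[B [[[V oV <-]|[z [V [iz oV ->]]]] By BU]].
  by apply: filterE => y'; apply: BU; exact: By.
case: By BU => y' Vy' e; have ezx : z = x by exact: (congr1 (@projT1 _ _) e).
subst z; have {}e : y' = y by exact: eq_from_Tagged e.
subst y'; move=> BU; apply: (@filterS _ _ _ V) => [w Vw|].
  by apply: BU; exists w.
by apply: open_nbhs_nbhs.
Qed.

Lemma lexprod_hausdorff (X : topologicalType) (Y : X -> topologicalType) :
  hausdorff_space X -> (forall x, hausdorff_space (Y x)) ->
  (forall x, ~ isolated [set: X] x -> forall y y' : Y x, y = y') ->
  hausdorff_space (lexprod Y).
Proof.
move=> hX hY Y1 [x y] [x' y'] cl.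
have xx' : x = x'.
  apply: hX => A B Ax Bx'.
  have [||v [Av Bv]] := cl (@lexprod_proj X Y @^-1` A)
    (@lexprod_proj X Y @^-1` B).
  - exact: (@lexprod_proj_continuous X Y (existT Y x y) A Ax).
  - exact: (@lexprod_proj_continuous X Y (existT Y x' y') B Bx').
  - by exists (lexprod_proj v).
subst x'; congr existT.
have [ix|nix] := pselect (isolated [set: X] x); last exact: Y1.
have openimg (z : Y x) A : nbhs z A ->
    nbhs (existT Y x z : lexprod Y) (existT Y x @` A).
  rewrite nbhsE => -[V [oV Vz] VA]; apply/lexprod_nbhsP.
  exists (existT Y x @` V); split; [by right; exists x, V|by exists z|].
  by move=> _ [w /VA Aw <-]; exists w.
apply: hY => A B /openimg Ay /openimg By'.
have [_ [[a Aa <-] [b Bb ba]]] := cl _ _ Ay By'.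
by exists a; split => //; rewrite -(eq_from_Tagged ba).
Qed.

Lemma lex_hausdorff : hausdorff_space (lexprod Yfam).
Proof.
apply: lexprod_hausdorff; first exact: Nstar_hausdorff.
- by case=> [n|]; [exact: Z2_hausdorff|exact: discrete_hausdorff].
- by case=> [n /(_ (Nstar_isolated n))|_ [] []].
Qed.

(** The base sets of the second kind lie over isolated points, and infinity is
    not one. *)
Lemma lex_nbhs_none (y : Yfam None) (U : set (lexprod Yfam)) :
  nbhs (existT Yfam None y : lexprod Yfam) U ->
  exists N, forall n (z : Z2), (N <= n)%N -> U (existT Yfam (Some n) z).
Proof.
move=> /lexprod_nbhsP[B [[[V oV <-]|[a [V [ia _ ->]]]] Bu BU]].
  have /Nstar_nbhs_none[_ [N VN]] : nbhs (None : Nstar) V.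
    exact: open_nbhs_nbhs.
  by exists N => n z Nn; apply: BU; exact: VN.
case: Bu => w _ ew; case: Nstar_not_isolated.
have <- : a = None by exact: (congr1 (@projT1 _ _) ew).
exact: ia.
Qed.

Lemma lexN_same T (a : Nstar) (y y' : Yfam a) :
  lexN T (existT Yfam a y, existT Yfam a y') <-> Sfam a (y, y').
Proof.
split=> [|yy']; last by right; exists a, y, y'.
move=> [[_ nd]|[b [z [z' [/= yz yz']]]]]; first by case: nd.
have ab : a = b by exact: (congr1 (@projT1 _ _) yz).
by subst b; rewrite (eq_from_Tagged yz) (eq_from_Tagged yz').
Qed.

Lemma lexN_diff T (a b : Nstar) (y : Yfam a) (z : Yfam b) : a <> b ->
  lexN T (existT Yfam a y, existT Yfam b z) <-> T (a, b).
Proof.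
move=> ab; split=> [|Tab]; last by left.
move=> [[Tab _ //]|[c [w [w' [/= yw zw' _]]]]].
case: ab; transitivity c; first exact: (congr1 (@projT1 _ _) yw).
exact: (esym (congr1 (@projT1 _ _) zw')).
Qed.

Lemma lexN_proj T u v : is_tournament T ->
  lexN T (u, v) -> T (lexprod_proj u, lexprod_proj v).
Proof.
move=> tT [[Tuv _] //|[a [y [y' [/= -> -> _]]]]]; exact: tournament_refl.
Qed.

Lemma lexN_cycle_fiber T n (x y z : Z2) : cycle3 Ahat x y z ->
  cycle3 (lexN T) (existT Yfam (Some n) x) (existT Yfam (Some n) y)
    (existT Yfam (Some n) z).
Proof.
have strict (u v : Z2) : strict_part Ahat (u, v) ->
    strict_part (lexN T) (existT Yfam (Some n) u, existT Yfam (Some n) v).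
  move=> [uv nuv]; split; first exact/lexN_same.
  by move=> e; apply: nuv; exact: (eq_from_Tagged e).
by move=> [xy yz zx]; split; exact: strict.
Qed.

Lemma lexN_cycle_base T a b c (x : Yfam a) (y : Yfam b) (z : Yfam c) :
  cycle3 T a b c ->
  cycle3 (lexN T) (existT Yfam a x) (existT Yfam b y) (existT Yfam c z).
Proof.
have strict a' b' (x' : Yfam a') (y' : Yfam b') : strict_part T (a', b') ->
    strict_part (lexN T) (existT Yfam a' x', existT Yfam b' y').
  move=> [ab nab]; split; first exact/lexN_diff.
  by move=> e; apply: nab; exact: (congr1 (@projT1 _ _) e).
by move=> [ab bc ca]; split; exact: strict.
Qed.

(** Three consecutive indices form a 3-cycle of L1, so a closed set that contains
    (0, 0) and every 3-cycle it meets climbs from fiber to fiber, and reaches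
    infinity as a limit. *)
Lemma lexN_no_arc e : ~ has_arc_quotient (lexN (Ltour e)).
Proof.
pose pt n z : lexprod Yfam := existT Yfam (Some n) z.
apply: (no_arc_quotient (p := pt 0%N 0)) => C clC C0 cC.
have cC2 a b c : cycle3 (lexN (Ltour e)) a b c -> C a -> C c.
  move=> abc Ca; have Cb := cC _ _ _ abc Ca.
  by case: abc => ab bc ca; apply: (cC b c a) => //; split.
have fib n z z' : C (pt n z) -> C (pt n z').
  have [->//|/Ahat_arc_cyclic[w H]|/Ahat_arc_cyclic[w H]] :=
    tournament_trichotomy Ahat_tournament z z'.
    exact: (cC _ _ _ (lexN_cycle_fiber _ n H)).
  move: H => [zz' zw wz].
  apply: cC2; apply: (lexN_cycle_fiber _ n).
  by split; [exact: zw|exact: wz|exact: zz'].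
have fin n : C (pt n 0).
  elim: n => // n Cn.
  have : cycle3 (Ltour e) (Some n) (Some n.+1) (Some n.+2) \/
         cycle3 (Ltour e) (Some n) (Some n.+2) (Some n.+1).
    case: e {cC cC2} => /=; [right|left]; split; split;
      rewrite /L1 /=; try lia; case; lia.
  case=> H.
  - exact: (cC _ _ _ (@lexN_cycle_base _ (Some n) (Some n.+1) (Some n.+2)
      (0 : Z2) (0 : Z2) (0 : Z2) H) Cn).
  - exact: (cC2 _ _ _ (@lexN_cycle_base _ (Some n) (Some n.+2) (Some n.+1)
      (0 : Z2) (0 : Z2) (0 : Z2) H) Cn).
apply/seteqP; split => // -[[n|] y] _; first exact: fib (fin n).
apply: clC => U /lex_nbhs_none[N NU].
by exists (pt N 0); split; [exact: fin|apply: NU; exact: leqnn].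
Qed.

(** * Coordinates on a 2-adic section *)

Definition valuation (u : Z2) : Nstar :=
  if pselect (exists n, u n) is left ex then Some (ex_minn ex) else None.

Definition lex_tail (u : Z2) (a : Nstar) : Yfam a :=
  if a is Some n then iter n.+2 Z2_shift u else tt.

(** The coordinates of u in the product: the position of the leading 1 of u,
    and the digits after the one that follows it.  That omitted digit is constant
    on a cone, so nothing is lost there. *)
Definition lex_coord (u : Z2) : lexprod Yfam :=
  existT Yfam (valuation u) (lex_tail u (valuation u)).

Lemma valuation_lead n u : lead_at n u -> valuation u = Some n.
Proof.
move=> [u0 un]; rewrite /valuation; case: pselect => [ex|[]]; last by exists n.
congr Some; case: ex_minnP => m um mmin; apply/eqP; rewrite eqn_leq mmin //.
by rewrite leqNgt; apply/negP => /u0; rewrite um.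
Qed.

Lemma valuation0 : valuation 0 = None.
Proof. by rewrite /valuation; case: pselect => // -[]. Qed.

Lemma lex_coord_lead n u :
  lead_at n u -> lex_coord u = existT Yfam (Some n) (iter n.+2 Z2_shift u).
Proof. by move=> nu; rewrite /lex_coord (valuation_lead nu). Qed.

Lemma lex_coord0 : lex_coord 0 = existT Yfam None tt.
Proof. by rewrite /lex_coord valuation0. Qed.

Lemma near_lead n u : lead_at n u -> \forall v \near u, lead_at n v.
Proof.
move=> [u0 un]; apply: filterS (Z2_near_prefix u n.+1) => v vu; split=> [j jn|].
  by rewrite vu ?u0 // ltnW.
by rewrite vu.
Qed.

Lemma lex_coord_continuous : continuous lex_coord.
Proof.
move=> u; have [->|/lead_exists[n nu]] := pselect (u = 0).
  move=> U nU; have [N NU] : exists N, forall n (z : Z2), (N <= n)%N ->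
      U (existT Yfam (Some n) z).
    by apply: (@lex_nbhs_none tt); rewrite -lex_coord0.
  apply: filterS (Z2_near_prefix 0 N) => v v0.
  have [->|/lead_exists[n nv]] := pselect (v = 0).
    exact: nbhs_singleton nU.
  rewrite /= (lex_coord_lead nv); apply: NU; rewrite leqNgt; apply/negP => /v0.
  by case: nv => _ ->.
move=> U; rewrite (lex_coord_lead nu) => nU.
have : \forall v \near u, U (existT Yfam (Some n) (iter n.+2 Z2_shift v)).
  apply: (@continuous_comp _ _ _ (iter n.+2 Z2_shift : Z2 -> Z2)
    (existT Yfam (Some n) : Z2 -> lexprod Yfam)) nU.
    exact: shift_continuous.
  exact: (lexprod_fiber_continuous (Nstar_isolated n)).
by apply: filterS2 (near_lead nu) => v nv; rewrite /= (lex_coord_lead nv).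
Qed.

Lemma lex_coord_inj e u v : cone e u -> cone e v ->
  lex_coord u = lex_coord v -> u = v.
Proof.
move=> cu cv.
have [->|/lead_exists[n nu]] := pselect (u = 0).
  have [->//|/lead_exists[m mv]] := pselect (v = 0).
  by rewrite lex_coord0 (lex_coord_lead mv) => /(congr1 (@projT1 _ _)).
have [->|/lead_exists[m mv]] := pselect (v = 0).
  by rewrite lex_coord0 (lex_coord_lead nu) => /(congr1 (@projT1 _ _)).
rewrite (lex_coord_lead nu) (lex_coord_lead mv) => uv.
have [nm] : Some n = Some m by exact: (congr1 (@projT1 _ _) uv).
subst m; apply: (@shift_inj n.+2); last exact: (eq_from_Tagged uv).
have [u0 un] := nu; have [v0 vn] := mv.
move=> j; rewrite ltnS leq_eqVlt => /predU1P[->|].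
  by rewrite (cu _ nu) (cv _ mv).
by rewrite ltnS leq_eqVlt => /predU1P[->|jn]; [rewrite un vn|rewrite u0 ?v0].
Qed.

Lemma lex_coord_surj e a : exists2 u, cone e u & lex_coord u = a.
Proof.
case: a => -[n|] z; last first.
  exists 0; last by rewrite lex_coord0; case: z.
  by move=> n /lead_neq0.
pose u := prepend n.+2
  (fun k => if k == n then true else if k == n.+1 then e else false) z.
have nu : lead_at n u.
  split=> [j jn|]; rewrite /u /prepend; last by rewrite leqW // eqxx.
  by rewrite !ltnS !ltn_eqF ?(leqW (ltnW jn)) // ltnW.
exists u; last by rewrite (lex_coord_lead nu) shift_prepend.
move=> m /(lead_uniq nu) <-.
by rewrite /u /prepend ltnSn eqxx gtn_eqF.
Qed.

Lemma Ahat_differ n x y :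
  differ_at n x y -> Ahat (x, y) <-> x n.+1 (+) y n.+1 = x n.
Proof.
move=> nxy; rewrite Ahat_arc; split=> [[xy|[m [mxy e]]]|e].
- by case: nxy => _ []; rewrite xy.
- by rewrite (differ_uniq nxy mxy).
- by right; exists n.
Qed.

(** Points with leading 1 at i < j first differ at i, where the first has digit
    1; behind it they have the digits e and, as a leading 1 at j requires,
    (j == i+1). *)
Lemma lex_coord_lt e u v i j : cone e u -> cone e v ->
  lead_at i u -> lead_at j v -> (i < j)%N ->
  (Ahat (u, v) <-> lexN (Ltour e) (lex_coord u, lex_coord v)) /\
  (Ahat (v, u) <-> lexN (Ltour e) (lex_coord v, lex_coord u)).
Proof.
move=> cu cv iu jv ij; have [L1 L2] := Ltour_lt e ij.
have ij' : Some i <> Some j by case; lia.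
rewrite (lex_coord_lead iu) (lex_coord_lead jv).
rewrite !lexN_diff; [|exact: nesym|exact: ij'].
rewrite L1 L2.
have [u0 ui] := iu; have [v0 vj] := jv.
have uv : differ_at i u v.
  by split=> [k ki|]; [rewrite u0 ?v0 //; exact: ltn_trans ij|rewrite ui v0].
have vi : v i.+1 = (j == i.+1).
  by case: eqVneq => [<-//|ji]; apply: v0; lia.
rewrite (Ahat_differ uv) (Ahat_differ (differ_sym uv)) vi (cu _ iu) ui (v0 _ ij).
by case: e {cu cv L1 L2}; case: (j == i.+1).
Qed.

Lemma lex_coord_none e u i : cone e u -> lead_at i u ->
  (Ahat (u, 0) <-> lexN (Ltour e) (lex_coord u, lex_coord 0)) /\
  (Ahat (0, u) <-> lexN (Ltour e) (lex_coord 0, lex_coord u)).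
Proof.
move=> cu iu; have [L1 L2] := Ltour_none e i.
rewrite lex_coord0 (lex_coord_lead iu) !lexN_diff // L1 L2.
have [_ ui] := iu; have /lead_differ u0 := iu.
rewrite (Ahat_differ u0) (Ahat_differ (differ_sym u0)) (cu _ iu) ui !Z2_zeroE.
by case: e {cu L1 L2}.
Qed.

Lemma lex_coord_rel e u v : cone e u -> cone e v ->
  Ahat (u, v) <-> lexN (Ltour e) (lex_coord u, lex_coord v).
Proof.
move=> cu cv.
have [->|/lead_exists[i iu]] := pselect (u = 0).
  have [->|/lead_exists[j jv]] := pselect (v = 0).
    rewrite lex_coord0 lexN_same; split => // _.
    by apply: tournament_refl; exact: Ahat_tournament.
  by have [] := lex_coord_none cv jv.
have [->|/lead_exists[j jv]] := pselect (v = 0).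
  by have [] := lex_coord_none cu iu.
have [ij|ji|ij] := ltngtP i j.
- by have [] := lex_coord_lt cu cv iu jv ij.
- by have [] := lex_coord_lt cv cu jv iu ji.
subst j; rewrite (lex_coord_lead iu) (lex_coord_lead jv) lexN_same.
apply: shift_Ahat => k; rewrite ltnS leq_eqVlt => /predU1P[->|].
  by rewrite (cu _ iu) (cv _ jv).
have [u0 ui] := iu; have [v0 vi] := jv.
by rewrite ltnS leq_eqVlt => /predU1P[->|ki]; [rewrite ui vi|rewrite u0 ?v0].
Qed.

(** * Base quotient maps and fibers *)

Lemma isomorphism_comp (X Y Z : topologicalType) (R : set (X * X))
    (S : set (Y * Y)) (T : set (Z * Z)) f g :
  isomorphism R S f -> isomorphism S T g -> isomorphism R T (g \o f).
Proof.
move=> [fq fI] [gq gI]; split; first exact: quotient_map_comp fq gq.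
by move=> x y /gI /fI.
Qed.

Lemma quotient_trivial (X Y : topologicalType) (R : set (X * X))
    (S : set (Y * Y)) h : quotient_map R S h -> trivial X -> trivial Y.
Proof.
move=> [[[_ [[x _] _ _] _] _] _ _ hs _] /(trivialP x) X1.
apply/(trivialP (h x)) => y; have [//|x' _ <-] := hs y.
by rewrite (X1 x').
Qed.

Lemma base_quotient_prime (X Y : topologicalType) (R : set (X * X))
    (S : set (Y * Y)) h :
  quotient_map R S h -> almost_wac R -> ~ has_arc_quotient R ->
  prime_tournament S -> base_quotient_map R S h.
Proof. by move=> hq wR nR pS; split => //; [right|exact: quotient_trivial hq]. Qed.

Lemma wac_almost_wac (X : topologicalType) (R : set (X * X)) :
  wac R -> almost_wac R.
Proof.
move=> [cR wR]; split => // x; have [?|/wR ?] := pselect (isolated [set: X] x).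
  by constructor 1.
by constructor 2.
Qed.

Lemma wac_point (X : topologicalType) (R : set (X * X)) :
  compact_tournament R -> (forall x y : X, x = y) -> wac R.
Proof.
move=> cR X1; split => // x; case; split; first by rewrite inE.
exists setT; first exact: filterT.
by rewrite setIT; apply/seteqP; split => // y _; exact: X1.
Qed.

Lemma base_quotient_point (X Y : topologicalType) (R : set (X * X))
    (S : set (Y * Y)) h :
  quotient_map R S h -> (forall x y : X, x = y) -> base_quotient_map R S h.
Proof.
move=> hq X1; have [cR _ _ _ _] := hq.
have [[_ [[x _] _ _] _] _] := cR.
have tX : trivial X by apply/(trivialP x).
split => //.
- by left; exact: wac_point.
- by move=> _; exact: quotient_trivial hq tX.
- move=> [Z [T [q [Z2 qq]]]].
  have tZ : trivial Z by exact: quotient_trivial qq tX.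
  have [a [b [ab _]]] := two_pointsP Z2.
  by case: (nontrivial ab).
Qed.

Lemma cycle_point_restr (X : topologicalType) (R : set (X * X)) (A : set X)
    (x : A) : cycle_point R (set_val x) -> nbhs (set_val x) A ->
  cycle_point (restr_rel R A) x.
Proof.
move=> cx xA U [_ [[W oW <-] Wx] sWU].
have /cx[y [z [[Wy Ay] [Wz Az] [xy yz zx]]]] : nbhs (set_val x) (W `&` A).
  by apply: filterI => //; apply: open_nbhs_nbhs; split => //;
     move: Wx; rewrite /= set_valE.
have strict (u v : A) : strict_part R (set_val u, set_val v) ->
    strict_part (restr_rel R A) (u, v).
  move=> [uv nuv]; split => // e; apply: nuv.
  by rewrite /diagonal /= in e *; rewrite e.
exists (set_elt Ay), (set_elt Az); split.
- by apply: sWU; rewrite /= set_eltE.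
- by apply: sWU; rewrite /= set_eltE.
- by split; apply: strict; rewrite !set_eltE.
Qed.

(** A fiber of p o k corresponds under the isomorphism k to a fiber of p; both
    levels of the classifier are of this form, with p the projection and p the
    identity. *)
Lemma fiber_isomorphism (X Y Z : topologicalType) (R : set (X * X))
    (S : set (Y * Y)) (k : X -> Y) (p : Y -> Z) (h : X -> Z) (a : Z) :
  isomorphism R S k -> (forall x, h x = p (k x)) ->
  hausdorff_space Z -> continuous p -> (exists y, p y = a) ->
  exists g : h @^-1` [set a] -> p @^-1` [set a],
    (forall x, set_val (g x) = k (set_val x)) /\
    isomorphism (restr_rel R (h @^-1` [set a]))
      (restr_rel S (p @^-1` [set a])) g.
Proof.
move=> [[cR cS ck ks km] kI] hpk hZ cp [y0 py0].
have [[hY tS _] _] := cS; have [[_ tR _] _] := cR.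
have inF (x : h @^-1` [set a]) : (p @^-1` [set a]) (k (set_val x)).
  by have := set_valP x; rewrite /= hpk.
pose g (x : h @^-1` [set a]) : p @^-1` [set a] := set_elt (inF x).
have gE x : set_val (g x) = k (set_val x) by exact: set_eltE.
have ch : continuous h.
  have -> : h = p \o k by exact/funext.
  by move=> x; apply: continuous_comp; [exact: ck|exact: cp].
exists g; split => //; apply: isomorphism_intro.
- apply: restr_compact_tournament => //.
    apply: preimage_closed => [x _|]; [exact: ch|exact: hausdorff_closed1].
  by have [//|x _ kx] := ks y0; exists x; rewrite /= hpk kx.
- exact: hausdorff_inj (@set_val_continuous _ _) (@set_val_inj _ _) hY.
- apply: continuous_set_val => x; rewrite (_ : (fun x => _) = k \o set_val).
    by apply: continuous_comp; [exact: set_val_continuous|exact: ck].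
  by apply/funext => u; rewrite gE.
- move=> x x' gxx'; apply: (@set_val_inj _ (h @^-1` [set a])); apply: kI.
  by rewrite -!gE gxx'.
- move=> y _; have [//|x _ kx] := ks (set_val y).
  have hx : (h @^-1` [set a]) x by rewrite /= hpk kx; exact: (set_valP y).
  exists (set_elt hx) => //.
  by apply: (@set_val_inj _ (p @^-1` [set a])); rewrite gE set_eltE.
- move=> x x'; rewrite /restr_rel /= !gE; split; first exact: km.
  move=> Sk; have [//|xx'] := tournament_total tR (set_val x) (set_val x').
  have /kI -> := tournament_anti tS Sk (km _ _ xx').
  exact: tournament_refl.
Qed.

(** * The sections of the 2-adic tournament *)

(** The out-set of x for e = 0 and its in-set for e = 1, in coordinates centred
    at x; see [rayP]. *)
Definition ray (e : bool) (x : Z2) : set Z2 := [set y | cone e (y - x)].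

Lemma rayP e x y : ray e x y <-> if e then Ahat (y, x) else Ahat (x, y).
Proof.
have refl : Ahat (x, x) by apply: tournament_refl; exact: Ahat_tournament.
have [->|/differ_exists[n nxy]] := pselect (y = x).
  rewrite /ray /= subrr; split=> _; last by move=> n /lead_neq0.
  by case: e.
have next := sub_next (differ_sym nxy).
have lead := lead_sub (differ_sym nxy).
have -> : ray e x y <-> (y - x) n.+1 = e.
  by split=> [/(_ _ lead)//|e' m /(lead_uniq lead) <-].
rewrite next; case: e.
  rewrite (Ahat_differ nxy); case: nxy => _.
  by case: (x n) (y n) (x n.+1) (y n.+1) => -[] [] [].
rewrite (Ahat_differ (differ_sym nxy)).
by case: (x n) (x n.+1) (y n.+1) => -[] [].
Qed.

Lemma xsection_ray x : xsection Ahat x = ray false x.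
Proof.
apply/seteqP; split => y; first by move/xsectionP => xy; exact/rayP.
by move/rayP => xy; apply/xsectionP.
Qed.

Lemma xsection_inv_ray x : xsection (Ahat^-1)%relation x = ray true x.
Proof.
apply/seteqP; split => y; first by move/xsectionP => xy; exact/rayP.
by move/rayP => yx; apply/xsectionP.
Qed.

Lemma sub_continuous (x : Z2) : continuous (fun y : Z2 => y - x).
Proof.
move=> y U nU; have [[A B] /= [Ay Bx] AB] := @Z2_add_continuous (y, - x) U nU.
apply: (@filterS _ (nbhs y) _ A) => // z Az; apply: (AB (z, - x)); split => //=.
exact: nbhs_singleton Bx.
Qed.

Lemma near_cone e n u : lead_at n u -> cone e u -> nbhs u (cone e).
Proof.
move=> nu cu; apply: filterS2 (near_lead nu) (Z2_near_coord u n.+1) => v nv vu.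
by move=> m /(lead_uniq nv) <-; rewrite vu cu.
Qed.

Lemma cone_closed e : closed (cone e).
Proof.
rewrite -[cone e]setCK; apply: open_closedC; rewrite openE => u cu.
have [n [nu un]] : exists n, lead_at n u /\ u n.+1 <> e.
  apply: contra_notP cu => H n nu; apply: contrapT => un; apply: H.
  by exists n.
apply: filterS2 (near_lead nu) (Z2_near_coord u n.+1) => v nv vu cv.
by apply: un; rewrite -vu cv.
Qed.

Lemma ray_closed e x : closed (ray e x).
Proof.
apply: (@preimage_closed _ _ (fun y : Z2 => y - x)); last exact: cone_closed.
by move=> y _; exact: sub_continuous.
Qed.

(** A point other than the centre is interior to its ray, since membership is
    decided by the digits of y - x up to the one behind the leading 1. *)
Lemma ray_nbhs e x y : ray e x y -> y <> x -> nbhs y (ray e x).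
Proof.
move=> xy /eqP; rewrite -subr_eq0 => /eqP /lead_exists[n nyx].
exact: (@sub_continuous x y _ (near_cone nyx xy)).
Qed.

Definition ray_coord e x (y : ray e x) : lexprod Yfam :=
  lex_coord (set_val y - x).

Lemma ray_isomorphism e x :
  isomorphism (restr_rel Ahat (ray e x)) (lexN (Ltour e)) (@ray_coord e x).
Proof.
have sx : ray e x x by rewrite /ray /= subrr => n /lead_neq0.
apply: isomorphism_intro.
- apply: restr_compact_tournament; [exact: Ahat_compact|exact: ray_closed|].
  by exists x.
- exact: lex_hausdorff.
- move=> y; apply: (@continuous_comp _ _ _ set_val (fun y => lex_coord (y - x))).
    exact: set_val_continuous.
  apply: (@continuous_comp _ _ _ (fun y : Z2 => y - x) lex_coord).
    exact: sub_continuous.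
  exact: lex_coord_continuous.
- move=> y z /(lex_coord_inj (set_valP y) (set_valP z)) /addIr.
  exact: (@set_val_inj _ (ray e x)).
- move=> a _; have [u cu ua] := lex_coord_surj e a.
  have ux : ray e x (u + x) by rewrite /ray /= addrK.
  exists (set_elt ux) => //.
  by rewrite /ray_coord set_eltE addrK.
- move=> y z; rewrite -(lex_coord_rel (set_valP y) (set_valP z)).
  by rewrite Ahat_translate.
Qed.

Lemma ray_no_arc e x : ~ has_arc_quotient (restr_rel Ahat (ray e x)).
Proof.
have [g [[gq _] _ _]] := isomorphism_inverse (ray_isomorphism e x).
by move=> /(has_arc_quotient_comp gq); exact: lexN_no_arc.
Qed.

Lemma ray_cycle_point e x (y : ray e x) :
  set_val y <> x -> cycle_point (restr_rel Ahat (ray e x)) y.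
Proof.
move=> yx; apply: cycle_point_restr; first exact: Ahat_cycle_point.
by apply: ray_nbhs => //; exact: set_valP.
Qed.

(** The centre x is terminal in its in-set and initial in its out-set. *)
Lemma ray_almost_wac e x : almost_wac (restr_rel Ahat (ray e x)).
Proof.
have [[cR _ _ _ _] _] := ray_isomorphism e x; split => // y.
have [yx|/ray_cycle_point] := pselect (set_val y = x); last by constructor 2.
have anti := tournament_anti Ahat_tournament.
case: e cR y yx => _ y yx; [constructor 4|constructor 3];
  apply/seteqP; split => // z /xsectionP[/= yz nyz]; apply: nyz;
  apply: set_val_inj; have /rayP zx := set_valP z.
- by apply: anti => //=; rewrite yx.
- by apply/anti => //=; rewrite yx.
Qed.

Lemma lexN_compact e : compact_tournament (lexN (Ltour e)).
Proof. by have [[]] := ray_isomorphism e 0. Qed.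

Lemma lexprod_proj_quotient e :
  quotient_map (lexN (Ltour e)) (Ltour e) (@lexprod_proj Nstar Yfam).
Proof.
split; [exact: lexN_compact|exact: Ltour_compact|
        exact: lexprod_proj_continuous| |].
- by case=> [n|] _; [exists (existT _ (Some n) (0 : Z2))|exists (existT _ None tt)].
- by move=> u v; apply: lexN_proj; case: (Ltour_compact e) => -[].
Qed.

Lemma lexN_fiber_isomorphism e n :
  exists k, isomorphism Ahat
    (restr_rel (lexN (Ltour e))
       (@lexprod_proj Nstar Yfam @^-1` [set Some n])) k.
Proof.
pose G := @lexprod_proj Nstar Yfam @^-1` [set Some n].
have inG (z : Z2) : G (existT Yfam (Some n) z) by [].
pose k z : G := set_elt (inG z).
have kE z : set_val (k z) = existT Yfam (Some n) z by exact: set_eltE.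
exists k; apply: isomorphism_intro.
- exact: Ahat_compact.
- exact: hausdorff_inj (@set_val_continuous _ _) (@set_val_inj _ _) lex_hausdorff.
- apply: continuous_set_val.
  rewrite (_ : (fun z => _) = existT Yfam (Some n)); last by apply/funext => z; exact: kE.
  exact: (lexprod_fiber_continuous (Nstar_isolated n)).
- move=> z z' /(congr1 set_val); rewrite !kE => e'; exact: eq_from_Tagged e'.
- move=> y _; have an : lexprod_proj (set_val y) = Some n := set_valP y.
  case E : (set_val y) an => [a z] /= an.
  subst a; exists z => //; apply: (@set_val_inj _ G); by rewrite kE E.
- by move=> z z'; rewrite /restr_rel /= !kE lexN_same.
Qed.

Lemma ray_coord_base e x (y : ray e x) : set_val y = x ->
  lexprod_proj (ray_coord y) = None.
Proof. by rewrite /ray_coord => ->; rewrite subrr lex_coord0. Qed.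

Lemma ray_coord_lead e x (y : ray e x) i : lead_at i (set_val y - x) ->
  lexprod_proj (ray_coord y) = Some i.
Proof. by rewrite /ray_coord => /lex_coord_lead ->. Qed.

Lemma ray_classifier e x :
  classifier_system (restr_rel Ahat (ray e x))
    (two_level_rel (Ltour e) (lexN (Ltour e)))
    (two_level_bond (@lexprod_proj Nstar Yfam))
    (two_level_map (@lexprod_proj Nstar Yfam) (@ray_coord e x)).
Proof.
have iso := ray_isomorphism e x; have [phiq phiI] := iso.
have projq := lexprod_proj_quotient e.
have pphiq := quotient_map_comp phiq projq.
(* a fiber of a map that factors through the isomorphism, when the
   corresponding fiber on the other side is a single point *)
have point (Z : topologicalType) (p : lexprod Yfam -> Z) (a : Z) :
    hausdorff_space Z -> continuous p -> (exists y, p y = a) ->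
    (forall y y', p y = a -> p y' = a -> y = y') ->
    let F := (p \o @ray_coord e x) @^-1` [set a] in
    let G := p @^-1` [set a] in
    wac (restr_rel (restr_rel Ahat (ray e x)) F) /\
    exists g : F -> G, (forall y, set_val (g y) = ray_coord (set_val y)) /\
      base_quotient_map (restr_rel (restr_rel Ahat (ray e x)) F)
        (restr_rel (lexN (Ltour e)) G) g.
  move=> hZ cp pa p1 F G.
  have [g [gE [gq gI]]] := fiber_isomorphism iso (fun _ => erefl) hZ cp pa.
  have F1 (y y' : F) : y = y'.
    apply: gI; apply: (@set_val_inj _ G); apply: p1.
      exact: (set_valP (g y)).
    exact: (set_valP (g y')).
  split; first by apply: wac_point => //; case: gq.
  by exists g; split => //; exact: base_quotient_point.
split.
- by case=> [|i] //=; apply: quotient_map_id; exact: lexN_compact.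
- by case.
- by case.
- apply: base_quotient_prime => //; [exact: ray_almost_wac|exact: ray_no_arc|].
  exact: Ltour_prime.
case=> [|i] a /=; last first.
  apply: (point _ id a lex_hausdorff); first by move=> y; exact: cvg_id.
    by exists a.
  by move=> y y' -> ->.
case: a => [n|]; last first.
  apply: point; first exact: Nstar_hausdorff.
  - exact: lexprod_proj_continuous.
  - by exists (existT Yfam None tt).
  - by move=> [[n|] t] [[m|] t'] //= _ _; case: t; case: t'.
have [g [gE giso]] := fiber_isomorphism iso (fun _ => erefl) Nstar_hausdorff
  (@lexprod_proj_continuous Nstar Yfam)
  (ex_intro _ (existT Yfam (Some n) (0 : Z2)) (erefl (Some n))).
have [k kiso] := lexN_fiber_isomorphism e n.
have [g' [g'iso _ _]] := isomorphism_inverse giso.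
have [kg'q _] := isomorphism_comp kiso g'iso.
set F := _ @^-1` _ in g gE giso g' g'iso kg'q *.
have wF : wac (restr_rel (restr_rel Ahat (ray e x)) F).
  split; first by case: kg'q.
  move=> y _; apply: cycle_point_restr.
    apply: ray_cycle_point => yx.
    have : lexprod_proj (ray_coord (set_val y)) = Some n := set_valP y.
    by rewrite (ray_coord_base yx).
  have [_ _ ch _ _] := pphiq.
  have nF : nbhs (lexprod_proj (ray_coord (set_val y))) [set Some n].
    have -> : lexprod_proj (ray_coord (set_val y)) = Some n := set_valP y.
    exact: Nstar_nbhs_some.
  exact: (ch (set_val y) _ nF).
split => //; exists g; split => //; apply: base_quotient_prime.
- by case: giso.
- exact: wac_almost_wac.
- move=> /(has_arc_quotient_comp kg'q).
  exact: arc_cyclic_no_arc_quotient Ahat_tournament Ahat_arc_cyclic.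
- exact: prime_isomorphism kiso Ahat_prime.
Qed.

(** The opposite of u first differs from 0 where u does. *)
Lemma lead_opp i u : lead_at i u -> lead_at i (- u).
Proof.
by move=> /lead_differ /differ_sym /lead_sub; rewrite sub0r.
Qed.

Lemma Apart_lead i u : Apart i u -> lead_at i u.
Proof. by move=> []. Qed.

Theorem theorem13p1 :
  (* (a) *)
  [/\ cantor_set Z2, topological_tournament Ahat, arc_cyclic Ahat &
      prime_tournament Ahat] /\
  (* (b) *)
  (homeomorphism (fun x : Z2 => - x : Z2) /\
   isomorphism Ahat (Ahat^-1)%relation (fun x : Z2 => - x : Z2)) /\
  (* (c) *)
  (forall (k : nat) (w : k.-tuple bool), (0 < k)%N ->
     isomorphism (restr_rel Ahat (cylinder w)) Ahat
       (fun y : cylinder w => iter k Z2_shift (set_val y))) /\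
  (* (d) *)
  (forall x : Z2,
     (exists phi : xsection Ahat x -> lexprod Yfam,
        [/\ isomorphism (restr_rel Ahat (xsection Ahat x))
              (lexN (L1^-1)%relation) phi,
            forall (i : nat) (y : xsection Ahat x),
              [set x + a | a in Apart i] (set_val y) ->
              lexprod_proj (phi y) = Some i,
            forall y : xsection Ahat x,
              set_val y = x -> lexprod_proj (phi y) = None &
            classifier_system (restr_rel Ahat (xsection Ahat x))
              (two_level_rel (L1^-1)%relation (lexN (L1^-1)%relation))
              (two_level_bond (@lexprod_proj Nstar Yfam))
              (two_level_map (@lexprod_proj Nstar Yfam) phi)]) /\
     (exists phi : xsection (Ahat^-1)%relation x -> lexprod Yfam,
        [/\ isomorphism (restr_rel Ahat (xsection (Ahat^-1)%relation x))
              (lexN L1) phi,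
            forall (i : nat) (y : xsection (Ahat^-1)%relation x),
              [set x + b | b in [set - a | a in Apart i]] (set_val y) ->
              lexprod_proj (phi y) = Some i,
            forall y : xsection (Ahat^-1)%relation x,
              set_val y = x -> lexprod_proj (phi y) = None &
            classifier_system (restr_rel Ahat (xsection (Ahat^-1)%relation x))
              (two_level_rel L1 (lexN L1))
              (two_level_bond (@lexprod_proj Nstar Yfam))
              (two_level_map (@lexprod_proj Nstar Yfam) phi)])).
Proof.
split.
  split; [exact: Z2_cantor| |exact: Ahat_arc_cyclic|exact: Ahat_prime].
  by case: Ahat_compact.
split; first by split; [exact: opp_homeomorphism|exact: opp_isomorphism].
split=> [k w _|x]; first exact: shift_isomorphism.
rewrite xsection_ray xsection_inv_ray; split.
- exists (@ray_coord false x); split.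
  + exact: (ray_isomorphism false).
  + move=> i y [a /Apart_lead ai ay]; apply: ray_coord_lead.
    by rewrite -ay addrC addKr.
  + exact: ray_coord_base.
  + exact: (ray_classifier false).
- exists (@ray_coord true x); split.
  + exact: (ray_isomorphism true).
  + move=> i y [_ [a /Apart_lead/lead_opp ai <-] ay]; apply: ray_coord_lead.
    by rewrite -ay addrC addKr.
  + exact: ray_coord_base.
  + exact: (ray_classifier true).
Qed.
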